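(* Let $n\in\mathbb N$, let $A$ be an $n\times n$ real matrix all of whose (complex) eigenvalues have positive real parts, and let $G:\mathbb R^n\to\mathbb R^n$ be as in the context. Let $f:(0,\infty)\to\mathbb R^n$ be a function that is continuous on $[T_f,\infty)$ for some $T_f\ge 0$. Let $T_0\ge0$ and let $y\in C^1((T_0,\infty),\mathbb R^n)$ be a solution of $y'=-Ay+G(y)+f(t)$ on $(T_0,\infty)$ with $y(t)\to0$ as $t\to\infty$. Let $(\mu_k)_{k=1}^\infty$ be a divergent, strictly increasing sequence of positive numbers such that the set $\mathcal S=\{\mu_k:k\in\mathbb N\}$ satisfies $x+x'\in\mathcal S$ for all $x,x'\in\mathcal S$ and contains $\operatorname{Re}\sigma(A)=\{\operatorname{Re}\Lambda:\Lambda\text{ is an eigenvalue of }A\}$. If $f(t)$ has the asymptotic expansion $$f(t)\sim\sum_{k=1}^\infty\widehat f_k(t)e^{-\mu_kt},\qquad\widehat f_k\in\mathcal F_1(\mathbb R^n)\text{ for }k\in\mathbb N,$$ then the solution $y(t)$ admits an asymptotic expansion $$y(t)\sim\sum_{k=1}^\infty\widehat q_k(t)e^{-\mu_kt},\qquad\widehat q_k\in\mathcal F_1(\mathbb R^n)\text{ for }k\in\mathbb N.$$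
   Context: $|\cdot|$ is the Euclidean norm. $u(t)=\mathcal O(h(t))$ means that there are $T,C>0$ with $|u(t)|\le Ch(t)$ for all $t\ge T$. Assumption on $G$: $G:\mathbb R^n\to\mathbb R^n$ is locally Lipschitz, and there exist functions $G_m:\mathbb R^n\to\mathbb R^n$, $m\ge 2$, each a homogeneous polynomial of degree $m$, such that for any $N\ge2$ there exists $\delta>0$ with $|G(x)-\sum_{m=2}^N G_m(x)|=\mathcal O(|x|^{N+\delta})$ as $x\to0$. $\mathcal F_1(\mathbb R^n)$ is the set of $\mathbb R^n$-valued S-polynomials, i.e. functions $g:\mathbb R\to\mathbb R^n$ that are finite sums of functions of the form $t^m\cos(\omega t)Z$ or $t^m\sin(\omega t)Z$ with $m\in\{0,1,2,\dots\}$, $\omega\in\mathbb R$, $Z\in\mathbb R^n$. Expansion: for $g:(T,\infty)\to\mathbb R^n$ and a divergent, strictly increasing sequence $(\gamma_k)$ of nonnegative numbers, $g(t)\sim\sum_{k=1}^\infty\widehat g_k(t)e^{-\gamma_kt}$ with $\widehat g_k\in\mathcal F_1(\mathbb R^n)$ means: for any $N\ge1$ there exists $\mu>\gamma_N$ such that $|g(t)-\sum_{k=1}^N\widehat g_k(t)e^{-\gamma_kt}|=\mathcal O(e^{-\mu t})$. *)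

(* Defs.v *)
From HB Require Import structures.
From mathcomp Require Import all_boot all_order all_algebra.
From mathcomp Require Import all_classical all_reals all_analysis.
From mathcomp Require Import complex.
(* Notations left out: they clash with those of mathcomp-analysis. *)
From mathcomp Require mpoly.
Import (canonicals, coercions) mpoly.

Set Implicit Arguments.
Unset Strict Implicit.
Unset Printing Implicit Defensive.

Import Order.TTheory GRing.Theory Num.Theory.
Import numFieldNormedType.Exports.

Local Open Scope classical_set_scope.
Local Open Scope ring_scope.

(* The norm that mathcomp-analysis puts on matrices is the max norm; it induces
   the same topology, but the estimates below use the Euclidean norm. *)
Definition enorm (R : realType) (n : nat) (x : 'cV[R]_n) : R :=
  Num.sqrt (\sum_(i < n) x i 0 ^+ 2).

Definition bigO_infty (R : realType) (n : nat) (u : R -> 'cV[R]_n) (h : R -> R)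
  : Prop :=
  exists T C : R, [/\ 0 < T, 0 < C &
    forall t, T <= t -> enorm (u t) <= C * h t].

Definition locally_lipschitz (R : realType) (n : nat) (G : 'cV[R]_n -> 'cV[R]_n)
  : Prop :=
  forall x, exists r L : R, [/\ 0 < r, 0 <= L &
    forall u v, enorm (u - x) < r -> enorm (v - x) < r ->
      enorm (G u - G v) <= L * enorm (u - v)].

(* P is given, coordinate by coordinate, by polynomials in n variables that are
   homogeneous of degree m; as usual, the zero polynomial is homogeneous of
   every degree. *)
Definition homogeneous_polynomial_map (R : realType) (n m : nat)
    (P : 'cV[R]_n -> 'cV[R]_n) : Prop :=
  exists p : 'I_n -> mpoly.mpoly n R,
    (forall i, p i \is mpoly.ishomog1 m (@mpoly.mdeg n)) /\
    (forall x i, P x i 0 = mpoly.meval (fun j => x j 0) (p i)).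

Definition assumption_G (R : realType) (n : nat) (G : 'cV[R]_n -> 'cV[R]_n)
  : Prop :=
  locally_lipschitz G /\
  exists Gm : nat -> 'cV[R]_n -> 'cV[R]_n,
    (forall m, (2 <= m)%N -> homogeneous_polynomial_map m (Gm m)) /\
    (forall N, (2 <= N)%N ->
      exists delta : R, 0 < delta /\
      exists r C : R, [/\ 0 < r, 0 < C &
        forall x, enorm x < r ->
          enorm (G x - \sum_(2 <= m < N.+1) Gm m x)
            <= C * enorm x `^ (N%:R + delta)]).

Definition S_monomial (R : realType) (n : nat) (g : R -> 'cV[R]_n) : Prop :=
  exists (m : nat) (w : R) (Z : 'cV[R]_n),
    (forall t, g t = (t ^+ m * cos (w * t)) *: Z) \/
    (forall t, g t = (t ^+ m * sin (w * t)) *: Z).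

Definition S_polynomial (R : realType) (n : nat) (g : R -> 'cV[R]_n) : Prop :=
  exists (N : nat) (h : 'I_N -> R -> 'cV[R]_n),
    (forall i, S_monomial (h i)) /\ (forall t, g t = \sum_(i < N) h i t).

(* Sequences are indexed from 0: gamma k and gh k stand for the terms of index
   k + 1, so the partial sum ending with gamma N consists of N + 1 terms. *)
Definition expansion (R : realType) (n : nat) (g : R -> 'cV[R]_n)
    (gh : nat -> R -> 'cV[R]_n) (gamma : nat -> R) : Prop :=
  (forall k, S_polynomial (gh k)) /\
  (forall N : nat, exists mu : R, gamma N < mu /\
    bigO_infty
      (fun t => g t - \sum_(k < N.+1) expR (- (gamma k * t)) *: gh k t)
      (fun t => expR (- (mu * t)))).

Definition complex_eigenvalue (R : realType) (n : nat) (A : 'M[R]_n) (z : R[i])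
  : bool :=
  eigenvalue (map_mx (real_complex R) A) z.

Definition C1_after (R : realType) (n : nat) (T0 : R) (y : R -> 'cV[R]_n)
  : Prop :=
  (forall t, T0 < t -> derivable y t 1) /\
  (forall t, T0 < t -> {for t, continuous (derive1 y)}).

(* Main.v *)
(**
  Suppose a finite sum [P] of
  S-polynomials times [e^{-mu_k t}], [k < N], is such that [y - P] decays faster
  than every term already present, and that [P] solves the equation, with [G]
  replaced by its Taylor polynomial, up to a finite sum of terms of index at
  least [N]. Then [z = y - P] solves
  [z' + A z = r e^{-mu_N t} + O(e^{-nu' t})] with [r] an S-polynomial and
  [nu' > mu_N], because [G] has no linear part and the exponents are closed
  under addition. Over the complex numbers [A] is triangularized, so this is a
  cascade of scalar equations [u' + lam u = ...]; each has an S-polynomial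
  solution [q] of [q' + (lam - mu_N) q = r], and what is left,
  [(e^{lam t} w)' = e^{lam t} O(e^{-nu' t})], is integrated by comparing
  monotone functions. The constant of integration is absorbed in [q] when
  [Re lam = mu_N], vanishes by the decay of [z] when [Re lam < mu_N], and is
  negligible when [Re lam > mu_N]. Since [q] satisfies its equation exactly, the
  hypothesis on [P] is inherited by [P + q e^{-mu_N t}], and no uniqueness of
  expansions is needed. The induction starts from [y = O(e^{-b t})] for all
  [b < mu_0], obtained with a weighted quadratic Lyapunov function in the
  triangularizing coordinates.
*)
Require Import Defs.
From HB Require Import structures.
From mathcomp Require Import all_boot all_order all_algebra.
From mathcomp Require Import all_classical all_reals all_analysis.
From mathcomp Require Import complex.
From mathcomp Require Import ring lra.
From mathcomp Require mpoly.
Import (canonicals, coercions) mpoly.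
Import Order.TTheory GRing.Theory Num.Theory.
Import numFieldNormedType.Exports.
Local Open Scope classical_set_scope.
Local Open Scope ring_scope.

Set Implicit Arguments.
Unset Strict Implicit.
Unset Printing Implicit Defensive.

(** * Exponential decay rates of real functions, and primitives of decaying functions *)

Section RealDecay.
Context {R : realType}.
Implicit Types (u v f g : R -> R) (a b c nu t s T C : R).

Lemma is_deriveD_fun f g t a b : is_derive t (1 : R) f a ->
  is_derive t (1 : R) g b -> is_derive t (1 : R) (fun s => f s + g s) (a + b).
Proof. exact: is_deriveD. Qed.

Lemma is_deriveB_fun f g t a b : is_derive t (1 : R) f a ->
  is_derive t (1 : R) g b -> is_derive t (1 : R) (fun s => f s - g s) (a - b).
Proof. exact: is_deriveB. Qed.

Lemma is_deriveM_fun f g t a b : is_derive t (1 : R) f a ->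
  is_derive t (1 : R) g b ->
  is_derive t (1 : R) (fun s => f s * g s) (a * g t + f t * b).
Proof.
move=> fa gb; have := is_deriveM fa gb.
by rewrite /GRing.scale /= addrC [g t * a]mulrC.
Qed.

Lemma is_deriveZ_fun f t a c : is_derive t (1 : R) f a ->
  is_derive t (1 : R) (fun s => c * f s) (c * a).
Proof. exact: is_deriveZ. Qed.

Lemma is_derive_sum_fun (I : finType) (h : I -> R -> R) (dh : I -> R) t :
  (forall i, is_derive t (1 : R) (h i) (dh i)) ->
  is_derive t (1 : R) (fun s => \sum_i h i s) (\sum_i dh i).
Proof.
move=> dhP; elim: (index_enum I) => [|i r ihr].
  rewrite big_nil; under eq_fun do rewrite big_nil.
  exact: is_derive_cst.
rewrite big_cons; under eq_fun do rewrite big_cons.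
exact: is_deriveD_fun.
Qed.

Lemma is_derive_comp_scale f c t a : is_derive (c * t) (1 : R) f a ->
  is_derive t (1 : R) (fun s => f (c * s)) (c * a).
Proof.
move=> fa; have idc : is_derive t (1 : R) (fun s => c * s) c.
  by have := is_deriveZ_fun c (is_derive_id t (1 : R)); rewrite mulr1.
by have := is_derive1_comp fa idc; rewrite mulrC.
Qed.

Lemma derive_le0_antimono f (f' : R -> R) T :
  (forall t, T < t -> is_derive t (1 : R) f (f' t)) ->
  (forall t, T < t -> f' t <= 0) ->
  forall s t, T < s -> s <= t -> f t <= f s.
Proof.
move=> df f'0 s t Ts st.
have D x : s <= x -> is_derive x (1 : R) f (f' x).
  by move=> sx; apply: df; exact: lt_le_trans sx.
apply: (@ler0_derive1_le_cc R f s t); last by [].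
- move=> x; rewrite in_itv /= => /andP[sx _].
  by have [] := D x (ltW sx).
- move=> x; rewrite in_itv /= => /andP[sx _].
  by rewrite derive1E (@derive_val _ _ _ _ _ _ _ (D x (ltW sx))) f'0// (lt_trans Ts).
- apply: continuous_in_subspaceT => x; rewrite inE /= in_itv /= => /andP[sx _].
  apply: differentiable_continuous; apply/derivable1_diffP.
  by have [] := D x sx.
- by rewrite in_itv /= st lexx.
- by rewrite in_itv /= st lexx.
Qed.

Lemma derive_ge0_mono f (f' : R -> R) T :
  (forall t, T < t -> is_derive t (1 : R) f (f' t)) ->
  (forall t, T < t -> 0 <= f' t) ->
  forall s t, T < s -> s <= t -> f s <= f t.
Proof.
move=> df f'0 s t Ts st.
rewrite -lerN2.
apply: (@derive_le0_antimono (fun x => - f x) (fun x => - f' x) T) => //.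
- by move=> x Tx; apply: is_deriveN; exact: df.
- by move=> x Tx; rewrite oppr_le0 f'0.
Qed.

(** The rate [nu] may be negative, and the property then bounds growth. [T] and [C] are
    unconstrained; [decayE] makes them positive. *)
Definition decay nu u :=
  exists T C, forall t, T <= t -> `|u t| <= C * expR (- (nu * t)).

Lemma decayE nu u : decay nu u ->
  exists T C, [/\ 0 < T, 0 < C &
    forall t, T <= t -> `|u t| <= C * expR (- (nu * t))].
Proof.
move=> [T [C H]]; exists (Num.max T 1), (Num.max C 1).
split; rewrite ?lt_max ?ltr01 ?orbT// => t; rewrite ge_max => /andP[Tt _].
by rewrite (le_trans (H _ Tt))// ler_wpM2r ?expR_ge0// le_max lexx.
Qed.

Lemma eventually_decay nu u v : decay nu u ->
  (exists T, forall t, T <= t -> v t = u t) -> decay nu v.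
Proof.
move=> [T [C H]] [T' E]; exists (Num.max T T'), C => t.
by rewrite ge_max => /andP[Tt T't]; rewrite E// H.
Qed.

Lemma le_decay nu u v : decay nu v ->
  (exists T, forall t, T <= t -> `|u t| <= `|v t|) -> decay nu u.
Proof.
move=> [T [C H]] [T' E]; exists (Num.max T T'), C => t.
by rewrite ge_max => /andP[Tt T't]; rewrite (le_trans (E _ T't))// H.
Qed.

Lemma decayW nu nu' u : nu' <= nu -> decay nu u -> decay nu' u.
Proof.
move=> nn' /decayE[T [C [T0 C0 H]]]; exists T, C => t Tt.
rewrite (le_trans (H _ Tt))// ler_wpM2l ?(ltW C0)// ler_expR lerN2 ler_wpM2r//.
by rewrite (le_trans _ Tt)// ltW.
Qed.

Lemma decayD nu u v : decay nu u -> decay nu v -> decay nu (fun t => u t + v t).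
Proof.
move=> [T [C H]] [T' [C' H']]; exists (Num.max T T'), (C + C') => t.
rewrite ge_max => /andP[Tt T't]; rewrite (le_trans (ler_normD _ _))// mulrDl.
by rewrite lerD ?H ?H'.
Qed.

Lemma decayN nu u : decay nu u -> decay nu (fun t => - u t).
Proof. by move=> [T [C H]]; exists T, C => t Tt; rewrite normrN H. Qed.

Lemma decayB nu u v : decay nu u -> decay nu v -> decay nu (fun t => u t - v t).
Proof. by move=> du dv; apply: decayD => //; exact: decayN. Qed.

Lemma decayM a b u v : decay a u -> decay b v ->
  decay (a + b) (fun t => u t * v t).
Proof.
move=> [T [C H]] [T' [C' H']]; exists (Num.max T T'), (C * C') => t.
rewrite ge_max => /andP[Tt T't]; rewrite normrM mulrDl opprD expRD mulrACA.
by rewrite ler_pM ?H ?H'.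
Qed.

Lemma decayZ nu c u : decay nu u -> decay nu (fun t => c * u t).
Proof.
move=> [T [C H]]; exists T, (`|c| * C) => t Tt.
by rewrite normrM -mulrA ler_wpM2l ?H.
Qed.

Lemma decay0 nu : decay nu (fun=> 0).
Proof. by exists 0, 0 => t _; rewrite normr0 mul0r. Qed.

Lemma decay_sum nu (I : Type) (r : seq I) (P : pred I) (h : I -> R -> R) :
  (forall i, P i -> decay nu (h i)) -> decay nu (fun t => \sum_(i <- r | P i) h i t).
Proof.
move=> dh; elim: r => [|i r ihr].
  by under eq_fun do rewrite big_nil; exact: decay0.
case Pi: (P i); under eq_fun do rewrite big_cons Pi; last by [].
by apply: decayD => //; exact: dh.
Qed.

Lemma decay_expR nu : decay nu (fun t => expR (- (nu * t))).
Proof. by exists 0, 1 => t _; rewrite ger0_norm ?expR_ge0// mul1r. Qed.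

Lemma decay_bounded u : (forall t, `|u t| <= 1) -> decay 0 u.
Proof. by move=> u1; exists 0, 1 => t _; rewrite mul0r oppr0 expR0 mulr1. Qed.

(** Since [1 + x <= expR x], each factor [t] costs an arbitrarily small rate. Half of [e] is spent
    on one factor and half on the others, so the induction quantifies over [e]. *)
Lemma decay_powX m (e : R) : 0 < e -> decay (- e) (fun t => t ^+ m).
Proof.
elim: m e => [|m ihm] e e0.
  apply: (@decayW 0); first by rewrite oppr_le0 ltW.
  by apply: decay_bounded => t; rewrite expr0 normr1.
have e20 : 0 < e / 2 by rewrite divr_gt0.
have d1 : decay (- (e / 2)) (fun t => t).
  exists 0, (e / 2)^-1 => t t0.
  rewrite ger0_norm// mulrC ler_pdivlMr// mulNr opprK mulrC.
  by rewrite (le_trans _ (expR_ge1Dx _))// lerDr.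
have := decayM d1 (ihm _ e20).
by rewrite -opprD -splitr; under eq_fun do rewrite -exprS.
Qed.

Lemma expR_eventually_small b C (e : R) : 0 < b -> 0 < e ->
  exists T, forall t, T <= t -> C * expR (- (b * t)) <= e.
Proof.
move=> b0 e0; have [C0|C0] := leP C 0.
  exists 0 => t _; apply: (@le_trans _ _ 0); last exact: ltW.
  by rewrite mulr_le0_ge0 ?expR_ge0.
(* From this time on, [C / e <= b * t <= expR (b * t)]. *)
exists (C / e / b) => t tT; rewrite expRN ler_pdivrMr ?expR_gt0//.
rewrite [leRHS]mulrC -ler_pdivrMr//; apply: (@le_trans _ _ (b * t)).
  by rewrite [leRHS]mulrC -ler_pdivrMr.
by rewrite (le_trans _ (expR_ge1Dx _))// lerDr.
Qed.

Lemma decay_cst c b : 0 < b -> decay b (fun=> c) -> c = 0.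
Proof.
move=> b0 [T [C H]]; apply/eqP; rewrite -normr_le0; apply/ler_addgt0Pl => e e0.
have [T' H'] := expR_eventually_small C b0 e0.
rewrite addr0 (le_trans (H (Num.max T T') _)) ?H'// le_max lexx ?orbT//.
Qed.

(* [g] is the primitive [- C / b * e^{-bt}] of the bound [C e^{-bt}] on [|u'|]. *)
Lemma primitive_sandwich b u (u' : R -> R) T : b != 0 ->
  (forall t, T < t -> is_derive t (1 : R) u (u' t)) -> decay b u' ->
  exists T' C, [/\ 0 < T', 0 < C & forall s t, T' <= s -> s <= t ->
    let g := fun x => - (C / b) * expR (- (b * x)) in
    u t - g t <= u s - g s /\ u s + g s <= u t + g t].
Proof.
move=> b0 du /decayE[T1 [C [T10 C0 H]]].
pose T' := Num.max T T1; exists (T' + 1), C.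
have TT' : T <= T' by rewrite le_max lexx.
have T1T' : T1 <= T' by rewrite le_max lexx orbT.
split=> //; first by rewrite addr_gt0// (lt_le_trans T10).
move=> s t T's st g.
have dg x : is_derive x (1 : R) g (C * expR (- (b * x))).
  have -> : g = fun z => - (C / b) * expR (- b * z).
    by apply/funext => z; rewrite [- b * z]mulNr.
  apply: is_derive_eq (is_deriveZ_fun _
    (is_derive_comp_scale (is_derive_expR (- b * x)))) _.
  by rewrite mulrA mulrNN divfK// mulNr.
have B x : T' < x -> `|u' x| <= C * expR (- (b * x)).
  by move=> T'x; apply: H; rewrite (le_trans T1T')// ltW.
have D x : T' < x -> is_derive x (1 : R) u (u' x).
  by move=> T'x; apply: du; exact: le_lt_trans T'x.
have T'sl : T' < s by rewrite (lt_le_trans _ T's)// ltrDl.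
split.
- apply: (@derive_le0_antimono (fun x => u x - g x)
    (fun x => u' x - C * expR (- (b * x))) T') => // x T'x.
  + exact: (is_deriveB_fun (D _ T'x) (dg x)).
  + by rewrite subr_le0 (le_trans (ler_norm _))// B.
- apply: (@derive_ge0_mono (fun x => u x + g x)
    (fun x => u' x + C * expR (- (b * x))) T') => // x T'x.
  + exact: (is_deriveD_fun (D _ T'x) (dg x)).
  + by have := B _ T'x; rewrite ler_norml => /andP[]; lra.
Qed.

(** For [b < 0] the bound on the derivative grows, so the constant of integration [M] is dominated
    by [M * expR (- (b * t))]. *)
Lemma decay_primitive_grow b u (u' : R -> R) T : b < 0 ->
  (forall t, T < t -> is_derive t (1 : R) u (u' t)) -> decay b u' -> decay b u.
Proof.
move=> b0 du du'.
have [T' [C [T'0 C0 H]]] := primitive_sandwich (ltr0_neq0 b0) du du'.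
pose M := `|u T'| + (C / - b) * expR (- (b * T')).
exists T', (M + C / - b) => t T't.
have [] := H T' t (lexx _) T't.
have -> : C / b = - (C / - b) by rewrite invrN mulrN opprK.
have E1 : 1 <= expR (- (b * t)).
  by rewrite -expR0 ler_expR -mulNr mulr_ge0 ?oppr_ge0 ?ltW// (lt_le_trans T'0).
have K0 : 0 <= C / - b by rewrite divr_ge0 ?oppr_ge0// ltW.
have KE0 : 0 <= C / - b * expR (- (b * T')) by rewrite mulr_ge0 ?expR_ge0.
have M0 : 0 <= M by rewrite addr_ge0.
have ME : M <= M * expR (- (b * t)) by rewrite ler_peMr.
have := ler_norm (u T'); have := ler_norm (- u T'); rewrite normrN.
rewrite mulrDl ler_norml; move: M0 ME KE0; rewrite /M.
set E := expR (- (b * t)); set E' := expR _; move: (C / - b) => K M0 ME KE0.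
move=> h1 h2 h3 h4; apply/andP; split; lra.
Qed.

(** By the sandwich, [u - e] is nondecreasing and [u + e] nonincreasing, where [e] is the primitive
    of the bound up to sign. The supremum of [u - e] separates the two, hence lies within [e t] of
    [u t]. *)
Lemma decay_primitive_cvg b u (u' : R -> R) T : 0 < b ->
  (forall t, T < t -> is_derive t (1 : R) u (u' t)) -> decay b u' ->
  exists c, decay b (fun t => u t - c).
Proof.
move=> b0 du du'.
have [T' [C [T'0 C0 H]]] := primitive_sandwich (lt0r_neq0 b0) du du'.
pose e t := C / b * expR (- (b * t)).
have e0 t : 0 <= e t by rewrite mulr_ge0 ?expR_ge0// divr_ge0// ltW.
pose S := [set u s - e s | s in [set s | T' <= s]].
have lohi s t : T' <= s -> T' <= t -> u s - e s <= u t + e t.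
  move=> T's T't; have [st|/ltW ts] := leP s t.
    by have [_] := H s t T's st; rewrite !mulNr -!/(e _) => h; have := e0 t; lra.
  by have [+ _] := H t s T't ts; rewrite !mulNr -!/(e _) => h; have := e0 s; lra.
have hi t : T' <= t -> sup S <= u t + e t.
  move=> T't; apply: ge_sup; first by exists (u T' - e T'), T' => //=.
  by move=> _ [s /= T's <-]; exact: lohi.
have lo s : T' <= s -> u s - e s <= sup S.
  move=> T's; apply: ub_le_sup; last by exists s.
  by exists (u T' + e T') => _ [x /= T'x <-]; exact: lohi.
exists (sup S), T', (C / b) => t T't; rewrite -/(e t).
by have := hi t T't; have := lo t T't; rewrite ler_norml => ? ?; apply/andP; split; lra.
Qed.
End RealDecay.

(** * Complex functions of a real variable, and complex S-polynomials *)

Section ComplexFunctions.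
Context {R : realType}.
Local Open Scope complex_scope.
Local Notation C := R[i].
Local Notation Re := (@complex.Re R).
Local Notation Im := (@complex.Im R).
Implicit Types (u v f g q r : R -> C) (t nu : R) (x y z w c : C).

Lemma eqC x y : Re x = Re y -> Im x = Im y -> x = y.
Proof. by case: x => ? ?; case: y => ? ? /= -> ->. Qed.

Lemma ReD x y : Re (x + y) = Re x + Re y. Proof. by case: x; case: y. Qed.
Lemma ImD x y : Im (x + y) = Im x + Im y. Proof. by case: x; case: y. Qed.
Lemma ReN x : Re (- x) = - Re x. Proof. by case: x. Qed.
Lemma ImN x : Im (- x) = - Im x. Proof. by case: x. Qed.
Lemma ReM x y : Re (x * y) = Re x * Re y - Im x * Im y.
Proof. by case: x; case: y. Qed.
Lemma ImM x y : Im (x * y) = Re x * Im y + Im x * Re y.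
Proof. by case: x; case: y. Qed.

Definition ReImE := (ReD, ImD, ReN, ImN, ReM, ImM).

Lemma Re_sum (I : Type) (s : seq I) (P : pred I) (F : I -> C) :
  Re (\sum_(i <- s | P i) F i) = \sum_(i <- s | P i) Re (F i).
Proof. by elim/big_rec2: _ => // i a b _ <-; rewrite ReD. Qed.

Lemma Im_sum (I : Type) (s : seq I) (P : pred I) (F : I -> C) :
  Im (\sum_(i <- s | P i) F i) = \sum_(i <- s | P i) Im (F i).
Proof. by elim/big_rec2: _ => // i a b _ <-; rewrite ImD. Qed.

(** The variable is real, so derivatives are taken on real and imaginary parts, and each rule
    reduces to its real counterpart. *)
Definition is_cderive t u d :=
  is_derive t (1 : R) (fun s => Re (u s)) (Re d) /\
  is_derive t (1 : R) (fun s => Im (u s)) (Im d).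

Lemma is_cderive_eq t u x y : is_cderive t u x -> x = y -> is_cderive t u y.
Proof. by move=> + <-. Qed.

Lemma is_cderive_cst t c : is_cderive t (fun=> c) 0.
Proof. by split; exact: is_derive_cst. Qed.

Lemma is_cderiveD t u v x y : is_cderive t u x -> is_cderive t v y ->
  is_cderive t (fun s => u s + v s) (x + y).
Proof.
move=> [u1 u2] [v1 v2]; split; rewrite ?ReD ?ImD.
  by under eq_fun do rewrite ReD; exact: is_deriveD_fun.
by under eq_fun do rewrite ImD; exact: is_deriveD_fun.
Qed.

Lemma is_cderiveM t u v x y : is_cderive t u x -> is_cderive t v y ->
  is_cderive t (fun s => u s * v s) (x * v t + u t * y).
Proof.
move=> [u1 u2] [v1 v2]; split.
  under eq_fun do rewrite ReM.
  apply: is_derive_eq (is_deriveB_fun (is_deriveM_fun u1 v1)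
    (is_deriveM_fun u2 v2)) _.
  by rewrite !ReImE; ring.
under eq_fun do rewrite ImM.
apply: is_derive_eq (is_deriveD_fun (is_deriveM_fun u1 v2)
  (is_deriveM_fun u2 v1)) _.
by rewrite !ReImE; ring.
Qed.

Lemma is_cderiveZ t u x c : is_cderive t u x ->
  is_cderive t (fun s => c * u s) (c * x).
Proof.
move=> ux; apply: is_cderive_eq (is_cderiveM (is_cderive_cst t c) ux) _.
by rewrite mul0r add0r.
Qed.

Lemma is_cderiveN t u x : is_cderive t u x -> is_cderive t (fun s => - u s) (- x).
Proof.
move=> ux; rewrite -mulN1r; under eq_fun do rewrite -mulN1r.
exact: is_cderiveZ.
Qed.

Lemma is_cderiveB t u v x y : is_cderive t u x -> is_cderive t v y ->
  is_cderive t (fun s => u s - v s) (x - y).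
Proof. by move=> ux vy; apply: is_cderiveD => //; exact: is_cderiveN. Qed.

Lemma is_cderive_sum t (I : finType) (h : I -> R -> C) (dh : I -> C) :
  (forall i, is_cderive t (h i) (dh i)) ->
  is_cderive t (fun s => \sum_i h i s) (\sum_i dh i).
Proof.
move=> dhP; split.
- under eq_fun do rewrite Re_sum; rewrite Re_sum.
  by apply: is_derive_sum_fun => i; have [] := dhP i.
- under eq_fun do rewrite Im_sum; rewrite Im_sum.
  by apply: is_derive_sum_fun => i; have [] := dhP i.
Qed.

Lemma is_cderive_real t (f : R -> R) (d : R) : is_derive t (1 : R) f d ->
  is_cderive t (fun s => (f s)%:C) d%:C.
Proof. by move=> fd; split => //=; exact: is_derive_cst. Qed.

(** This is $e^{zt}$, written with Euler's formula. *)
Definition cexp z t : C :=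
  (expR (Re z * t))%:C * (cos (Im z * t) +i* sin (Im z * t)).

Lemma cexpD z w t : cexp (z + w) t = cexp z t * cexp w t.
Proof.
rewrite /cexp ReD ImD !mulrDl expRD cosD sinD.
by apply: eqC; rewrite !ReImE /=; ring.
Qed.

Lemma cexp0 t : cexp 0 t = 1.
Proof. by rewrite /cexp /= !mul0r expR0 cos0 sin0 mul1r. Qed.

Lemma cexpNK z t : cexp (- z) t * cexp z t = 1.
Proof. by rewrite -cexpD addNr cexp0. Qed.

Lemma cexp_real (a : R) t : cexp a%:C t = (expR (a * t))%:C.
Proof. by rewrite /cexp /= mul0r cos0 sin0 mulr1. Qed.

Lemma is_cderive_cexp z t : is_cderive t (cexp z) (z * cexp z t).
Proof.
have dexp : is_cderive t (fun s => (expR (Re z * s))%:C)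
    (Re z * expR (Re z * t))%:C.
  by apply: is_cderive_real; apply: is_derive_comp_scale.
have dcis : is_cderive t (fun s => cos (Im z * s) +i* sin (Im z * s))
    ((Im z * - sin (Im z * t)) +i* (Im z * cos (Im z * t))).
  by split => /=; apply: is_derive_comp_scale.
apply: is_cderive_eq (is_cderiveM dexp dcis) _.
by rewrite /cexp; apply: eqC; rewrite !ReImE /=; ring.
Qed.

Definition cdecay nu u :=
  decay nu (fun t => Re (u t)) /\ decay nu (fun t => Im (u t)).

Lemma eventually_cdecay nu u v : cdecay nu u ->
  (exists T, forall t, T <= t -> v t = u t) -> cdecay nu v.
Proof.
move=> [u1 u2] [T E].
by split; [apply: eventually_decay u1 _|apply: eventually_decay u2 _];
  exists T => t Tt; rewrite E.
Qed.

Lemma cdecayW nu nu' u : nu' <= nu -> cdecay nu u -> cdecay nu' u.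
Proof. by move=> nn [? ?]; split; exact: decayW nn _. Qed.

Lemma cdecayD nu u v : cdecay nu u -> cdecay nu v ->
  cdecay nu (fun t => u t + v t).
Proof.
move=> [? ?] [? ?]; split.
  by under eq_fun do rewrite ReD; exact: decayD.
by under eq_fun do rewrite ImD; exact: decayD.
Qed.

Lemma cdecayM (a b : R) u v : cdecay a u -> cdecay b v ->
  cdecay (a + b) (fun t => u t * v t).
Proof.
move=> [? ?] [? ?]; split.
  by under eq_fun do rewrite ReM; apply: decayB; exact: decayM.
by under eq_fun do rewrite ImM; apply: decayD; exact: decayM.
Qed.

Lemma cdecay_cst c : cdecay 0 (fun=> c).
Proof.
split; [exists 0, (`|Re c|) | exists 0, (`|Im c|)] => t _;
  by rewrite mul0r oppr0 expR0 mulr1.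
Qed.

Lemma cdecayZ nu c u : cdecay nu u -> cdecay nu (fun t => c * u t).
Proof. by move=> du; rewrite -[nu]add0r; apply: cdecayM => //; exact: cdecay_cst. Qed.

Lemma cdecayN nu u : cdecay nu u -> cdecay nu (fun t => - u t).
Proof. by move=> du; under eq_fun do rewrite -mulN1r; exact: cdecayZ. Qed.

Lemma cdecayB nu u v : cdecay nu u -> cdecay nu v ->
  cdecay nu (fun t => u t - v t).
Proof. by move=> du dv; apply: cdecayD => //; exact: cdecayN. Qed.

Lemma cdecay_sum nu (I : Type) (s : seq I) (P : pred I) (h : I -> R -> C) :
  (forall i, P i -> cdecay nu (h i)) ->
  cdecay nu (fun t => \sum_(i <- s | P i) h i t).
Proof.
move=> dh; split.
- by under eq_fun do rewrite Re_sum; apply: decay_sum => i /dh[].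
- by under eq_fun do rewrite Im_sum; apply: decay_sum => i /dh[].
Qed.

Lemma cdecay_real nu (f : R -> R) : decay nu f -> cdecay nu (fun t => (f t)%:C).
Proof. by move=> df; split => //=; exact: decay0. Qed.

Lemma cdecay_cexp z : cdecay (- Re z) (cexp z).
Proof.
rewrite -[- Re z]addr0; apply: cdecayM.
  apply: cdecay_real; have := decay_expR (- Re z).
  by under eq_fun do rewrite mulNr opprK.
split => /=; apply: decay_bounded => t.
- by rewrite ler_norml cos_geN1 cos_le1.
- by rewrite ler_norml sin_geN1 sin_le1.
Qed.

(** Complex S-polynomials. With $e^{i\omega t}$ in place of cosine and sine, a product of two
    monomials is again a monomial, and so is the derivative up to lower degree. *)
Inductive csp : (R -> C) -> Prop :=
| csp_mono c (m : nat) (w : R) :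
    csp (fun t => c * (t ^+ m)%:C * cexp (0 +i* w) t)
| cspD u v : csp u -> csp v -> csp (fun t => u t + v t).

Lemma csp_eq u v : csp u -> u =1 v -> csp v.
Proof. by move=> cu /funext <-. Qed.

Lemma csp_cst c : csp (fun=> c).
Proof.
apply: csp_eq (csp_mono c 0 0) _ => t.
by rewrite expr0 mulr1 cexp0 mulr1.
Qed.

Lemma cspM u v : csp u -> csp v -> csp (fun t => u t * v t).
Proof.
move=> cu cv; elim: cu => [c m w|u1 u2 _ ih1 _ ih2]; last first.
  by apply: csp_eq (cspD ih1 ih2) _ => t; rewrite mulrDl.
elim: cv => [c' m' w'|v1 v2 _ ih1 _ ih2]; last first.
  by apply: csp_eq (cspD ih1 ih2) _ => t; rewrite mulrDr.
apply: csp_eq (csp_mono (c * c') (m + m') (w + w')) _ => t.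
have -> : 0 +i* (w + w') = (0 +i* w) + (0 +i* w') by apply: eqC => /=; rewrite ?addr0.
by rewrite cexpD exprD rmorphM /=; ring.
Qed.

Lemma cspZ c u : csp u -> csp (fun t => c * u t).
Proof. by move=> cu; apply: cspM => //; exact: csp_cst. Qed.

Lemma cspB u v : csp u -> csp v -> csp (fun t => u t - v t).
Proof.
move=> cu cv; apply: cspD => //.
by apply: csp_eq (cspZ (-1) cv) _ => t; rewrite mulN1r.
Qed.

Lemma csp_sum (I : Type) (s : seq I) (P : pred I) (h : I -> R -> C) :
  (forall i, P i -> csp (h i)) -> csp (fun t => \sum_(i <- s | P i) h i t).
Proof.
move=> dh; elim: s => [|i s ihs].
  by under eq_fun do rewrite big_nil; exact: csp_cst.
case Pi: (P i); under eq_fun do rewrite big_cons Pi; last by [].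
by apply: cspD => //; exact: dh.
Qed.

(** The real part is half the sum of the function and its conjugate; conjugating a monomial
    conjugates [c] and negates [w]. *)
Lemma csp_Re u : csp u -> csp (fun t => (Re (u t))%:C).
Proof.
elim=> {u} [c m w|u v _ ihu _ ihv]; last first.
  by apply: csp_eq (cspD ihu ihv) _ => t; rewrite ReD rmorphD.
apply: csp_eq (cspD (csp_mono (c / 2) m w) (csp_mono (conjc c / 2) m (- w))) _ => t.
have -> : 0 +i* (- w) = - (0 +i* w) by apply: eqC; rewrite ?ReN ?ImN //= oppr0.
have half z : z / 2 = (Re z / 2) +i* (Im z / 2).
  have -> : (2 : C)^-1 = (2^-1)%:C by rewrite fmorphV rmorph_nat.
  by apply: eqC; rewrite !ReImE /=; ring.
case: c => a b; rewrite !half /cexp.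
by apply: eqC;
  rewrite !ReImE /= ?ReImE /= ?oppr0 ?mul0r ?expR0 ?mulNr ?cosN ?sinN; field.
Qed.

Lemma cdecay_csp (e : R) u : 0 < e -> csp u -> cdecay (- e) u.
Proof.
move=> e0; elim=> {u} [c m w|u v _ ihu _ ihv]; last exact: cdecayD.
rewrite -[- e]addr0; apply: cdecayM.
  by apply: cdecayZ; apply: cdecay_real; exact: decay_powX.
by have := cdecay_cexp (0 +i* w); rewrite /= oppr0.
Qed.

(** For [m = 0] the truncated exponent [m.-1] does no harm, because its coefficient [m%:R]
    vanishes. *)
Lemma is_cderive_exponomial c m z t :
  is_cderive t (fun s => c * (s ^+ m)%:C * cexp z s)
    (c * (m%:R * t ^+ m.-1)%:C * cexp z t + z * (c * (t ^+ m)%:C * cexp z t)).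
Proof.
have dX : is_derive t (1 : R) (fun s => s ^+ m) (m%:R * t ^+ m.-1).
  have -> : (fun s : R => s ^+ m) = (id : R -> R) ^+ m.
    by apply/funext => s; elim: m => // m ih; rewrite !exprS ih.
  apply: is_derive_eq (is_deriveX m (is_derive_id t (1 : R))) _.
  by rewrite /GRing.scale /= mulr1.
apply: is_cderive_eq (is_cderiveM (is_cderiveZ c (is_cderive_real dX))
  (is_cderive_cexp z t)) _.
by ring.
Qed.

(** By linearity [r] may be taken to be a monomial of frequency [w]. Two cases arise, according to
    whether $e^{i\omega t}$ solves the homogeneous equation. *)
Lemma csp_linear_ode r z : csp r ->
  exists2 q, csp q & forall t, is_cderive t q (r t - z * q t).
Proof.
elim=> {r} [c m w|r1 r2 _ [q1 cq1 dq1] _ [q2 cq2 dq2]]; last first.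
  exists (fun t => q1 t + q2 t); first exact: cspD.
  by move=> t; apply: is_cderive_eq (is_cderiveD (dq1 t) (dq2 t)) _; ring.
(* Resonance: the exponential solves the homogeneous equation, and integrating the power raises the
   degree by one. *)
have [zw|zw] := eqVneq (z + 0 +i* w) 0.
  exists (fun t => c / m.+1%:R * (t ^+ m.+1)%:C * cexp (0 +i* w) t).
    exact: csp_mono.
  move=> t; apply: is_cderive_eq (is_cderive_exponomial _ _ _ _) _.
  have -> : z = - (0 +i* w) by apply/eqP; rewrite -addr_eq0 zw.
  rewrite mulNr opprK; congr (_ + _); congr (_ * _).
  by rewrite rmorphM rmorph_nat /= mulrA divfK// pnatr_eq0.
elim: m c => [|m ihm] c.
  exists (fun t => c / (z + 0 +i* w) * (t ^+ 0)%:C * cexp (0 +i* w) t).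
    exact: csp_mono.
  move=> t; apply: is_cderive_eq (is_cderive_exponomial _ _ _ _) _.
  rewrite mul0r mulr0 mul0r add0r.
  set e := cexp _ _; set x := (t ^+ 0)%:C.
  by move: (0 +i* w) zw => i zw; field.
(* Without resonance, dividing the monomial by $z+i\omega$ leaves an error of degree one less, which
   the induction hypothesis corrects. *)
have [q cq dq] := ihm (c * m.+1%:R / (z + 0 +i* w)).
exists (fun t => c / (z + 0 +i* w) * (t ^+ m.+1)%:C * cexp (0 +i* w) t - q t).
  by apply: cspB => //; exact: csp_mono.
move=> t; apply: is_cderive_eq (is_cderiveB (is_cderive_exponomial _ _ _ _) (dq t)) _.
rewrite rmorphM rmorph_nat /=.
set e := cexp _ _; set x := (t ^+ m)%:C; set x' := (t ^+ m.+1)%:C.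
by move: (0 +i* w) zw => i zw; field.
Qed.

End ComplexFunctions.

(** * Scalar and lower triangular linear equations with S-polynomial forcing *)

Section LinearSolver.
Context {R : realType}.
Local Open Scope complex_scope.
Local Notation C := R[i].
Local Notation Re := (@complex.Re R).
Local Notation Im := (@complex.Im R).
Implicit Types (u v q r : R -> C) (t nu : R) (z w c lam : C).

Lemma cdecay_primitive_grow (b : R) u (u' : R -> C) (T : R) : b < 0 ->
  (forall t, T < t -> is_cderive t u (u' t)) -> cdecay b u' -> cdecay b u.
Proof.
move=> b0 du [? ?]; split.
- by apply: (@decay_primitive_grow _ b _ (fun t => Re (u' t)) T) => // t /du[].
- by apply: (@decay_primitive_grow _ b _ (fun t => Im (u' t)) T) => // t /du[].
Qed.

Lemma cdecay_primitive_cvg (b : R) u (u' : R -> C) (T : R) : 0 < b ->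
  (forall t, T < t -> is_cderive t u (u' t)) -> cdecay b u' ->
  exists c, cdecay b (fun t => u t - c).
Proof.
move=> b0 du [d1 d2].
have [t /du[]//|c1 c1P] :=
  @decay_primitive_cvg _ b (fun t => Re (u t)) (fun t => Re (u' t)) T b0 _ d1.
have [t /du[]//|c2 c2P] :=
  @decay_primitive_cvg _ b (fun t => Im (u t)) (fun t => Im (u' t)) T b0 _ d2.
exists (c1 +i* c2); split.
- by under eq_fun do rewrite ReD ReN.
- by under eq_fun do rewrite ImD ImN.
Qed.

Lemma scalar_step u r (rho : R -> C) lam (kap nu nu' T : R) :
  (forall t, T < t ->
    is_cderive t u (cexp (- kap%:C) t * r t + rho t - lam * u t)) ->
  csp r -> cdecay nu' rho -> kap < nu' -> cdecay nu u ->
  Re lam < nu \/ kap <= Re lam ->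
  exists q, [/\ csp q,
    forall t, is_cderive t q (r t + (kap%:C - lam) * q t) &
    exists2 nu'', kap < nu'' &
      cdecay nu'' (fun t => u t - cexp (- kap%:C) t * q t)].
Proof.
move=> du cr drho kapnu' dnu lamP.
(* The shift by [kap] makes [e * q0] a particular solution for the forcing [e * r]; the difference
   [w] is then driven by [rho] alone. *)
have [q0 cq0 dq0] := csp_linear_ode (lam - kap%:C) cr.
have dq0' t : is_cderive t q0 (r t + (kap%:C - lam) * q0 t).
  by apply: is_cderive_eq (dq0 t) _; ring.
pose e := cexp (- kap%:C); pose w t := u t - e t * q0 t.
have dw t : T < t -> is_cderive t w (rho t - lam * w t).
  move=> Tt; apply: is_cderive_eq (is_cderiveB (du t Tt)
    (is_cderiveM (is_cderive_cexp (- kap%:C) t) (dq0 t))) _.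
  by rewrite /w -/(e t); ring.
have eq0_decay (d : R) : d < kap -> cdecay d (fun t => e t * q0 t).
  move=> dkap; rewrite (_ : d = kap - (kap - d)); last by ring.
  apply: cdecayM; last by apply: cdecay_csp => //; rewrite subr_gt0.
  by have := cdecay_cexp (- kap%:C); rewrite ReN opprK.
pose U t := cexp lam t * w t.
have dU t : T < t -> is_cderive t U (cexp lam t * rho t).
  move=> Tt; apply: is_cderive_eq (is_cderiveM (is_cderive_cexp lam t) (dw t Tt)) _.
  by rewrite /U; ring.
have wU t : w t = cexp (- lam) t * U t by rewrite /U mulrA cexpNK mul1r.
have decNlam (d : R) v : cdecay d v ->
    cdecay (Re lam + d) (fun t => cexp (- lam) t * v t).
  by move=> dv; apply: cdecayM => //; have := cdecay_cexp (- lam); rewrite ReN opprK.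
have decU' : cdecay (- Re lam + nu') (fun t => cexp lam t * rho t).
  by apply: cdecayM => //; exact: cdecay_cexp.
(* First the case [kap < Re lam], where homogeneous solutions are negligible. The rate [nu1] lies
   strictly between [kap] and [Re lam], so that [U] falls under the growing case of integration. *)
have [lamkap|kaplam] := leP (Re lam) kap; last first.
  exists q0; split => //.
  pose nu1 := Num.min nu' ((Re lam + kap) / 2).
  have nu1lam : nu1 < Re lam.
    by rewrite /nu1 gt_min; apply/orP; right; lra.
  exists nu1; first by rewrite /nu1 lt_min kapnu' /=; lra.
  have dU1 : cdecay (- Re lam + nu1) U.
    apply: (cdecay_primitive_grow _ dU); first by lra.
    by apply: cdecayW decU'; rewrite lerD2l ge_min lexx.
  have := decNlam _ _ dU1; rewrite addrA subrr add0r.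
  by under eq_fun do rewrite -wU.
have b0 : 0 < - Re lam + nu' by lra.
(* Now [U] tends to a constant, so [w] is [c * cexp (- lam) t] up to an error of rate [nu']. *)
have [c dc] := cdecay_primitive_cvg b0 dU decU'.
have := decNlam _ _ dc; rewrite addrA subrr add0r => dwc.
have [kaplam|ltlamkap] := leP kap (Re lam).
  (* Here [kap - lam] is purely imaginary, so this homogeneous solution is [e] times an S-polynomial
     of degree 0, which is added to [q0]. *)
  have {lamkap} lamkap : Re lam = kap by apply/eqP; rewrite eq_le lamkap.
  have kE : kap%:C - lam = 0 +i* (- Im lam).
    by apply: eqC; rewrite !ReImE /= ?lamkap; ring.
  pose h t := c * cexp (0 +i* (- Im lam)) t.
  exists (fun t => q0 t + h t); split.
  - apply: cspD => //; apply: csp_eq (csp_mono c 0 (- Im lam)) _ => t.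
    by rewrite expr0 mulr1.
  - move=> t; apply: is_cderive_eq (is_cderiveD (dq0' t)
      (is_cderiveZ c (is_cderive_cexp (0 +i* (- Im lam)) t))) _.
    by rewrite -/(h t) kE /h; ring.
  - exists nu' => //; apply: eventually_cdecay dwc _; exists 0 => t _.
    have -> : cexp (- lam) t * (U t - c) = w t - cexp (- lam) t * c.
      by rewrite mulrBr -wU.
    rewrite /h -kE [kap%:C - lam]addrC cexpD /w -/(e t).
    have := cexpNK kap%:C t; rewrite -/(e t).
    move: (e t) (cexp (- lam) t) (cexp kap%:C t) (q0 t) (u t) => x y x' q ut xx'.
    rewrite mulrDr opprD addrA; congr (_ - _).
    by rewrite -[RHS]mul1r -xx'; ring.
(* In the remaining case [w] decays faster than $e^{-\mathrm{Re}\,\lambda\, t}$: [u] does so by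
   hypothesis, and [e * q0] at every rate below [kap]. Hence [U] tends to 0 and [c = 0]. *)
have lamnu : Re lam < nu by case: lamP => //; rewrite leNgt ltlamkap.
pose nu1 := Num.min nu ((Re lam + kap) / 2).
have dw1 : cdecay nu1 w.
  apply: cdecayB; first by apply: cdecayW dnu; rewrite ge_min lexx.
  by apply: eq0_decay; rewrite gt_min; apply/orP; right; lra.
have nu1lam : Re lam < nu1 by rewrite lt_min lamnu /=; lra.
have dU1 : cdecay (- Re lam + nu1) U by apply: cdecayM => //; exact: cdecay_cexp.
pose b := Num.min (- Re lam + nu1) (- Re lam + nu').
have bgt0 : 0 < b by rewrite lt_min b0 andbT; lra.
have dcc : cdecay b (fun t => c).
  apply: eventually_cdecay (cdecayB (cdecayW _ dU1) (cdecayW _ dc)) _.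
  - by rewrite ge_min lexx.
  - by rewrite ge_min lexx orbT.
  - by exists 0 => t _; ring.
have c0 : c = 0.
  by case: dcc => d1 d2; apply: eqC; [exact: decay_cst d1|exact: decay_cst d2].
exists q0; split => //; exists nu' => //.
apply: eventually_cdecay dwc _; exists 0 => t _.
by rewrite c0 subr0 -wU.
Qed.

(** Forward substitution: since [B] is lower triangular, each row is a scalar equation once the
    previous rows are solved. *)
Lemma triangular_step n (B : 'M[C]_n) (z r rho : 'I_n -> R -> C) (kap nu nu' T : R) :
  (forall i j : 'I_n, (i < j)%N -> B i j = 0) ->
  (forall i t, T < t -> is_cderive t (z i)
    (cexp (- kap%:C) t * r i t + rho i t - \sum_k B i k * z k t)) ->
  (forall i, csp (r i)) -> (forall i, cdecay nu' (rho i)) -> kap < nu' ->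
  (forall i, cdecay nu (z i)) ->
  (forall i, Re (B i i) < nu \/ kap <= Re (B i i)) ->
  exists q : 'I_n -> R -> C, [/\ forall i, csp (q i),
    forall i t, is_cderive t (q i)
      (r i t + kap%:C * q i t - \sum_k B i k * q k t) &
    exists2 nu'', kap < nu'' &
      forall i, cdecay nu'' (fun t => z i t - cexp (- kap%:C) t * q i t)].
Proof.
move=> Btrig dz cr drho kapnu' dnu BP; pose e := cexp (- kap%:C).
(* Only the first [m] rows are claimed. The sums contain all [q k], but those beyond the diagonal
   have coefficient 0. *)
suff H m : (m <= n)%N -> exists q : 'I_n -> R -> C,
    exists nu'', kap < nu'' /\ forall i : 'I_n, (i < m)%N -> [/\ csp (q i),
      forall t, is_cderive t (q i)
        (r i t + kap%:C * q i t - \sum_k B i k * q k t) &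
      cdecay nu'' (fun t => z i t - e t * q i t)].
  have [q [nu'' [kapnu'' qP]]] := H n (leqnn n).
  exists q; split; [| |exists nu'' => //]; move=> i;
    by have [] := qP i (ltn_ord i).
elim: m => [_|m ihm mn].
  by exists (fun _ _ => 0), nu'.
have [q [nu1 [kapnu1 qP]]] := ihm (ltnW mn); pose i0 := Ordinal mn.
(* Each earlier unknown is split into [e * q k], which joins the S-polynomial forcing, and an error,
   which joins the remainder. *)
pose r' t := r i0 t - \sum_(k | k != i0) B i0 k * q k t.
pose rho' t := rho i0 t - \sum_(k | k != i0) B i0 k * (z k t - e t * q k t).
pose nu2 := Num.min nu' nu1.
have kapnu2 : kap < nu2 by rewrite lt_min kapnu'.
have lt_or_0 k : k != i0 -> (k < m)%N \/ B i0 k = 0.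
  move=> ki0; have [|mk] := ltnP k m; [by left|right].
  apply: Btrig => /=; rewrite ltn_neqAle mk andbT.
  by apply: contra ki0 => /eqP mE; apply/eqP/val_inj.
have ltm (i : 'I_n) : (i < m.+1)%N -> i != i0 -> (i < m)%N.
  rewrite ltnS leq_eqVlt => /orP[/eqP mE|//] /eqP[].
  exact: val_inj.
have [] := @scalar_step (z i0) r' rho' (B i0 i0) kap nu nu2 T _ _ _ kapnu2
  (dnu i0) (BP i0).
- move=> t Tt; apply: is_cderive_eq (dz i0 t Tt) _.
  rewrite (bigD1 i0)//= /r' /rho' -/(e t).
  have -> : \sum_(k | k != i0) B i0 k * (z k t - e t * q k t) =
      \sum_(k | k != i0) B i0 k * z k t - e t * \sum_(k | k != i0) B i0 k * q k t.
    by rewrite mulr_sumr -sumrB; apply: eq_bigr => k _; ring.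
  by ring.
- apply: cspB => //; apply: csp_sum => k ki0.
  case: (lt_or_0 _ ki0) => [/qP[? _ _]|->]; first exact: cspZ.
  by under eq_fun do rewrite mul0r; exact: csp_cst.
- apply: cdecayB; first by apply: cdecayW (drho i0); rewrite ge_min lexx.
  apply: cdecay_sum => k ki0.
  case: (lt_or_0 _ ki0) => [/qP[_ _ d]|->].
    by apply: cdecayZ; apply: cdecayW d; rewrite ge_min lexx orbT.
  by under eq_fun do rewrite mul0r; split => /=; exact: decay0.
move=> q1 [cq1 dq1 [nu3 kapnu3 dq]].
(* Redefining [q] at [i0] leaves the earlier equations intact, because [i0] is beyond their
   diagonal. *)
exists (fun k => if k == i0 then q1 else q k), (Num.min nu1 nu3).
split; first by rewrite lt_min kapnu1.
move=> i im; case: eqVneq => [->|ii0]; split => //.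
- move=> t; apply: is_cderive_eq (dq1 t) _.
  rewrite (bigD1 i0)//= eqxx /r'.
  have -> : \sum_(k | k != i0) B i0 k * (if k == i0 then q1 else q k) t =
      \sum_(k | k != i0) B i0 k * q k t.
    by apply: eq_bigr => k /negbTE->.
  by ring.
- by apply: cdecayW dq; rewrite ge_min lexx orbT.
- by have [] := qP i (ltm i im ii0).
- move=> t; have [_ + _] := qP i (ltm i im ii0); move=> /(_ t) dqi.
  apply: is_cderive_eq dqi _; congr (_ - _); apply: eq_bigr => k _.
  case: eqVneq => // ->; rewrite Btrig ?mul0r//=.
  exact: ltm.
- have [_ _ d] := qP i (ltm i im ii0).
  by apply: cdecayW d; rewrite ge_min lexx.
Qed.

End LinearSolver.

(** * Linear systems with a real matrix, by triangularization over the complex numbers *)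

Section VectorStep.
Context {R : realType}.
Local Open Scope complex_scope.
Local Notation C := R[i].
Local Notation Re := (@complex.Re R).

(** Schur's theorem, with [Q] the inverse of [P]. A diagonal entry of [B] is a root of its
    characteristic polynomial, and a left eigenvector [v] of [B] yields the left eigenvector
    [v *m P] of the complexified [A]. *)
Lemma triangularization n (A : 'M[R]_n) : (0 < n)%N ->
  exists P Q B : 'M[C]_n,
    [/\ Q *m P = 1%:M, P *m map_mx (real_complex R) A = B *m P,
      Q *m B = map_mx (real_complex R) A *m Q,
      forall i j : 'I_n, (i < j)%N -> B i j = 0 &
      forall i, complex_eigenvalue A (B i i)].
Proof.
move=> n0; rewrite /complex_eigenvalue; set AC := map_mx _ A.
have [P Pu] := spectral.Schur AC n0.
have Punit := spectral.unitarymx_unit Pu.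
rewrite /similar_to /= mxred.conjumx//; set B := _ *m _ => Btrig.
have PA : P *m AC = B *m P by rewrite /B mulmxKV.
exists P, (invmx P), B; split => //.
- by rewrite mulVmx.
- by rewrite /B !mulmxA mulVmx// mul1mx.
- by move/is_trig_mxP : Btrig.
move=> i; have : eigenvalue B (B i i).
  rewrite eigenvalue_root_char char_poly_trig// rootE horner_prod (bigD1 i)//=.
  by rewrite !hornerE subrr mul0r.
move=> /eigenvalueP[v vB v0]; apply/eigenvalueP; exists (v *m P).
  by rewrite -mulmxA PA mulmxA vB scalemxAl.
apply: contra v0 => /eqP vP0.
by rewrite -[v]mulmx1 -(mulmxV Punit) mulmxA vP0 mul0mx.
Qed.

(** Associativity of the matrix product in coordinates, the form that suits families of
    functions. *)
Lemma mulmx_sum n (P A B Q : 'M[C]_n) (v : 'I_n -> C) (i : 'I_n) :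
  P *m A = B *m Q ->
  \sum_k P i k * (\sum_l A k l * v l) = \sum_k B i k * (\sum_l Q k l * v l).
Proof.
move=> E; pose x : 'cV[C]_n := \col_l v l.
have app (M N : 'M[C]_n) :
    (M *m (N *m x)) i 0 = \sum_k M i k * (\sum_l N k l * v l).
  rewrite mxE; apply: eq_bigr => k _; rewrite mxE; congr (_ * _).
  by apply: eq_bigr => l _; rewrite mxE.
by rewrite -!app !mulmxA E.
Qed.

Lemma mulmx1_sum n (Q P : 'M[C]_n) (v : 'I_n -> C) (i : 'I_n) :
  Q *m P = 1%:M -> \sum_k Q i k * (\sum_l P k l * v l) = v i.
Proof.
move=> QP; rewrite (@mulmx_sum _ _ _ 1%:M 1%:M); last by rewrite mulmx1.
have one j (w : 'I_n -> C) : \sum_k (1%:M : 'M[C]_n) j k * w k = w j.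
  rewrite (bigD1 j)//= mxE eqxx mul1r big1 ?addr0// => k kj.
  by rewrite mxE eq_sym (negbTE kj) mul0r.
by rewrite !one.
Qed.

(** Multiplication by [P] makes the system triangular, and [Q] brings the solution back. Real parts
    may be taken at the end because all the data are real. *)
Lemma vector_step n (A : 'M[R]_n) (z r rho : 'I_n -> R -> R) (kap nu nu' T : R) :
  (0 < n)%N ->
  (forall i t, T < t -> is_derive t (1 : R) (z i)
    (expR (- (kap * t)) * r i t + rho i t - \sum_k A i k * z k t)) ->
  (forall i, csp (fun t => (r i t)%:C)) -> (forall i, decay nu' (rho i)) ->
  kap < nu' -> (forall i, decay nu (z i)) ->
  (forall x, complex_eigenvalue A x -> Re x < nu \/ kap <= Re x) ->
  exists q : 'I_n -> R -> R, [/\ forall i, csp (fun t => (q i t)%:C),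
    forall i t, is_derive t (1 : R) (q i)
      (r i t + kap * q i t - \sum_k A i k * q k t) &
    exists2 nu'', kap < nu'' &
      forall i, decay nu'' (fun t => z i t - expR (- (kap * t)) * q i t)].
Proof.
move=> n0 dz cr drho kapnu' dnu AP.
have [P [Q [B [QP PA QB Btrig Beig]]]] := triangularization A n0.
have eE t : cexp (- kap%:C) t = (expR (- (kap * t)))%:C.
  by rewrite -rmorphN cexp_real mulNr.
pose cx (v : 'I_n -> R -> R) i t := \sum_k P i k * (v k t)%:C.
have dcx nu0 v : (forall i, decay nu0 (v i)) -> forall i, cdecay nu0 (cx v i).
  by move=> dv i; apply: cdecay_sum => k _; apply: cdecayZ; exact: cdecay_real.
have [i t Tt|i|q [cq dq [nu'' kapnu'' decq]]] :=
  @triangular_step _ _ B (cx z) (cx r) (cx rho) kap nu nu' T Btrig _ _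
    (dcx _ _ drho) kapnu' (dcx _ _ dnu) (fun i => AP _ (Beig i)).
- apply: is_cderive_eq.
    by apply: is_cderive_sum => k; apply: is_cderiveZ; apply: is_cderive_real;
      exact: dz.
  rewrite -(mulmx_sum (fun l => (z l t)%:C) i PA) eE /cx mulr_sumr -big_split /=.
  rewrite -sumrB; apply: eq_bigr => k _.
  rewrite rmorphB rmorphD rmorphM rmorph_sum /=.
  rewrite (eq_bigr (fun l => map_mx (real_complex R) A k l * (z l t)%:C)); last first.
    by move=> l _; rewrite rmorphM mxE.
  by ring.
- by apply: csp_sum => k _; exact: cspZ.
pose w i t := \sum_k Q i k * q k t.
exists (fun i t => Re (w i t)); split.
- by move=> i; apply: csp_Re; apply: csp_sum => k _; exact: cspZ.
- move=> i t.
  have : is_cderive t (w i) ((r i t)%:C + kap%:C * w i t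
      - \sum_k (A i k)%:C * w k t).
    apply: is_cderive_eq.
      by apply: is_cderive_sum => k; apply: is_cderiveZ; exact: dq.
    have -> : \sum_k (A i k)%:C * w k t =
        \sum_k map_mx (real_complex R) A i k * (\sum_l Q k l * q l t).
      by apply: eq_bigr => k _; rewrite mxE.
    rewrite -(mulmx_sum _ _ QB) -[in RHS](mulmx1_sum (fun k => (r k t)%:C) i QP).
    rewrite /w mulr_sumr -big_split /= -sumrB; apply: eq_bigr => k _.
    by rewrite /cx; ring.
  have -> : \sum_k A i k * Re (w k t) = Re (\sum_k (A i k)%:C * w k t).
    by rewrite Re_sum; apply: eq_bigr => k _; rewrite ReM /= mul0r subr0.
  by case=> + _; rewrite !ReImE /= mul0r subr0.
- exists nu'' => // i.
  have : cdecay nu'' (fun t => \sum_k Q i k * (cx z k t - cexp (- kap%:C) t * q k t)).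
    by apply: cdecay_sum => k _; exact: cdecayZ.
  case=> + _; move=> d; apply: eventually_decay d _; exists 0 => t _.
  have -> : \sum_k Q i k * (cx z k t - cexp (- kap%:C) t * q k t) =
      (z i t)%:C - (expR (- (kap * t)))%:C * w i t.
    rewrite -(mulmx1_sum (fun k => (z k t)%:C) i QP) mulr_sumr -sumrB.
    by apply: eq_bigr => k _; rewrite eE /cx; ring.
  by rewrite !ReImE /= mul0r subr0.
Qed.

End VectorStep.

(** * Decay of solutions of a perturbed stable linear system *)

Section Lyapunov.
Context {R : realType}.
Local Open Scope complex_scope.
Local Notation C := R[i].
Local Notation Re := (@complex.Re R).
Local Notation Im := (@complex.Im R).
Implicit Types (x y : C).

(** With the integrating factor [expR (a * t)], and the forcing integrated explicitly, [W] is
    nonincreasing. *)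
Lemma gronwall_decay (V V' : R -> R) (a b K T : R) : b < a ->
  (forall t, T < t -> is_derive t (1 : R) V (V' t)) ->
  (forall t, T < t -> V' t <= - a * V t + K * expR (- (b * t))) ->
  (forall t, 0 <= V t) -> decay b V.
Proof.
move=> ba dV V'le V0.
pose W t := expR (a * t) * V t - K / (a - b) * expR ((a - b) * t).
have dW t : T < t -> is_derive t (1 : R) W
    (expR (a * t) * (a * V t + V' t - K * expR (- (b * t)))).
  move=> Tt; apply: is_derive_eq (is_deriveB_fun (is_deriveM_fun
    (is_derive_comp_scale (is_derive_expR (a * t))) (dV t Tt))
    (is_deriveZ_fun _ (is_derive_comp_scale (is_derive_expR ((a - b) * t))))) _.
  rewrite [(a - b) * t]mulrBl expRD.
  by field; rewrite subr_eq0 gt_eqF.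
have Wle s t : T < s -> s <= t -> W t <= W s.
  apply: (derive_le0_antimono dW) => x Tx.
  by apply: mulr_ge0_le0; [exact: expR_ge0|have := V'le x Tx; lra].
pose s := Num.max T 0 + 1.
have Ts : T < s by rewrite (@le_lt_trans _ _ (Num.max T 0)) ?le_max ?lexx// ltrDl.
have s0 : 0 < s by rewrite (@le_lt_trans _ _ (Num.max T 0)) ?le_max ?lexx ?orbT// ltrDl.
exists s, (K / (a - b) + `|W s|) => t st; rewrite ger0_norm//.
have t0 : 0 < t by exact: lt_le_trans st.
have Vt : V t = expR (- (a * t)) * W t + K / (a - b) * expR (- (b * t)).
  rewrite /W mulrBr mulrA -expRD addNr expR0 mul1r [(a - b) * t]mulrBl.
  have -> : expR (- (a * t)) * (K / (a - b) * expR (a * t - b * t)) =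
      K / (a - b) * expR (- (b * t)).
    by rewrite mulrCA -expRD; congr (_ * expR _); ring.
  by ring.
rewrite Vt mulrDl addrC lerD2l.
have ab : expR (- (a * t)) <= expR (- (b * t)).
  by rewrite ler_expR lerN2 ler_wpM2r// ltW.
apply: (@le_trans _ _ (expR (- (a * t)) * `|W s|)).
  by rewrite ler_wpM2l ?expR_ge0// (le_trans (Wle s t Ts st))// ler_norm.
by rewrite mulrC ler_wpM2l.
Qed.

Lemma decay_sqrt (b : R) (u : R -> R) : decay (b + b) (fun t => u t ^+ 2) -> decay b u.
Proof.
move=> /decayE[T [K [T0 K0 H]]]; exists T, (Num.sqrt K) => t Tt.
rewrite -(@ler_pXn2r _ 2)// ?nnegrE ?mulr_ge0 ?sqrtr_ge0 ?expR_ge0//.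
rewrite exprMn sqr_sqrtr ?(ltW K0)// -normrX (le_trans (H _ Tt))//.
by rewrite ler_wpM2l ?(ltW K0)// expr2 -expRD mulrDl opprD.
Qed.

Definition csq x : R := Re x ^+ 2 + Im x ^+ 2.
Definition cdot x y : R := Re x * Re y + Im x * Im y.

Lemma csq_ge0 x : 0 <= csq x. Proof. by rewrite addr_ge0 ?sqr_ge0. Qed.

Lemma csqM x y : csq (x * y) = csq x * csq y.
Proof. by rewrite /csq !ReImE; ring. Qed.

(** Young's inequality: the gap is $|\eta x-y|^2/\eta$. *)
Lemma cdot_le x y (eta : R) : 0 < eta ->
  2 * cdot x y <= eta * csq x + csq y / eta.
Proof.
move=> eta0; rewrite -subr_ge0.
have -> : eta * csq x + csq y / eta - 2 * cdot x y =
    ((eta * Re x - Re y) ^+ 2 + (eta * Im x - Im y) ^+ 2) / eta.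
  by rewrite /csq /cdot; field; exact: lt0r_neq0.
by rewrite divr_ge0 ?addr_ge0 ?sqr_ge0// ltW.
Qed.

(* The geometric weights make the strictly triangular part of [B] negligible. *)
Lemma lyapunov_ineq n (B : 'M[C]_n) (a eta del : R) (Z H : 'I_n -> C) :
  0 < eta -> 0 < del -> del <= 1 ->
  (forall i j : 'I_n, (i < j)%N -> B i j = 0) ->
  (forall i, a <= Re (B i i)) ->
  (forall i k, del * csq (B i k) <= eta ^+ 2) ->
  \sum_(i < n) del ^+ i * (2 * cdot (Z i) (H i - \sum_k B i k * Z k)) <=
  - (2 * a - (2 * n%:R + 1) * eta) * (\sum_(i < n) del ^+ i * csq (Z i)) +
  (\sum_(i < n) del ^+ i * csq (H i)) / eta.
Proof.
move=> eta0 del0 del1 Btrig Ba Bdel.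
pose v (i : 'I_n) := del ^+ i * csq (Z i).
have v0 i : 0 <= v i by rewrite mulr_ge0 ?csq_ge0// exprn_ge0// ltW.
(* Diagonal terms give the damping; the others are zero or absorbed with the small factor [eta]. *)
have pair (i k : 'I_n) : - (del ^+ i * (2 * cdot (Z i) (B i k * Z k))) <=
    (if k == i then - (2 * a) * v i else 0) + (eta * v i + eta * v k).
  have [->|ki] := eqVneq k i.
    have -> : cdot (Z i) (B i i * Z i) = Re (B i i) * csq (Z i).
      by rewrite /cdot /csq !ReImE; ring.
    have := Ba i; rewrite -subr_ge0 => Bai; have := mulr_ge0 Bai (v0 i).
    have := mulr_ge0 (ltW eta0) (v0 i); rewrite /v; lra.
  rewrite add0r; have [ltki|ik] := ltnP k i; last first.
    have -> : cdot (Z i) (B i k * Z k) = 0.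
      rewrite Btrig ?mul0r /cdot /= ?mulr0 ?addr0//.
      by rewrite ltn_neqAle ik andbT eq_sym.
    by rewrite mulr0 mulr0 oppr0 addr_ge0// mulr_ge0// ltW.
  (* For [k < i], row [i] weighs less than row [k] by a factor of at least [del]; this pays for
     [csq (B i k)] in Young's inequality. *)
  have delik : del ^+ i <= del * del ^+ k.
    rewrite -exprS; apply: ler_wiXn2l => //; exact: ltW.
  have -> : - (del ^+ i * (2 * cdot (Z i) (B i k * Z k))) =
      del ^+ i * (2 * cdot (Z i) (- (B i k * Z k))).
    by rewrite /cdot !ReN !ImN; ring.
  apply: (@le_trans _ _ (del ^+ i * (eta * csq (Z i) + csq (- (B i k * Z k)) / eta))).
    by rewrite ler_wpM2l ?cdot_le// exprn_ge0// ltW.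
  rewrite mulrDr; apply: lerD; first by rewrite /v mulrCA.
  have -> : csq (- (B i k * Z k)) = csq (B i k) * csq (Z k).
    by rewrite -csqM /csq !ReN !ImN !sqrrN.
  rewrite mulrA ler_pdivrMr//.
  have -> : eta * v k * eta = (del ^+ k * csq (Z k)) * eta ^+ 2 by rewrite /v; ring.
  apply: (@le_trans _ _ (del ^+ k * csq (Z k) * (del * csq (B i k)))).
    have -> : del ^+ k * csq (Z k) * (del * csq (B i k)) =
      (del * del ^+ k) * (csq (B i k) * csq (Z k)) by ring.
    by rewrite ler_wpM2r// mulr_ge0 ?csq_ge0.
  by rewrite ler_wpM2l ?v0 ?Bdel.
have row (i : 'I_n) : del ^+ i * (2 * cdot (Z i) (H i - \sum_k B i k * Z k)) <=
    - (2 * a) * v i + \sum_k (eta * v i + eta * v k) + eta * v i +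
      del ^+ i * csq (H i) / eta.
  have -> : del ^+ i * (2 * cdot (Z i) (H i - \sum_k B i k * Z k)) =
      \sum_k - (del ^+ i * (2 * cdot (Z i) (B i k * Z k))) +
      del ^+ i * (2 * cdot (Z i) (H i)).
    rewrite sumrN -mulr_sumr -mulr_sumr.
    have -> : \sum_k cdot (Z i) (B i k * Z k) = cdot (Z i) (\sum_k B i k * Z k).
      by rewrite /cdot Re_sum Im_sum !mulr_sumr -big_split.
    by rewrite /cdot !ReImE; ring.
  rewrite -addrA; apply: lerD.
    apply: le_trans; first by apply: ler_sum => k _; exact: pair.
    by rewrite big_split /= -big_mkcond big_pred1_eq.
  have -> : eta * v i + del ^+ i * csq (H i) / eta =
      del ^+ i * (eta * csq (Z i) + csq (H i) / eta) by rewrite /v; ring.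
  by rewrite ler_wpM2l ?cdot_le// exprn_ge0// ltW.
apply: le_trans; first by apply: ler_sum => i _; exact: row.
rewrite !big_split /= -!mulr_sumr -mulr_suml.
(* Every [v i] is counted [n] times as a row and [n] times as a column, whence [2 * n%:R * eta]; the
   further [eta] in the statement comes from the forcing. *)
have -> : \sum_(i < n) \sum_(k < n) (eta * v i + eta * v k) =
    2 * n%:R * eta * \sum_i v i.
  have inner (i : 'I_n) : \sum_(k < n) (eta * v i + eta * v k) =
      n%:R * eta * v i + eta * \sum_k v k.
    by rewrite big_split /= sumr_const card_ord -mulr_sumr -[_ *+ n]mulr_natl mulrA.
  under eq_bigr do rewrite inner.
  by rewrite big_split /= sumr_const card_ord -mulr_sumr -[_ *+ n]mulr_natl; ring.
by rewrite /v; lra.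
Qed.

Lemma complex_entries_bounded n (P : 'M[C]_n) :
  exists2 M : R, 0 < M & forall i k, `|Re (P i k)| <= M /\ `|Im (P i k)| <= M.
Proof.
pose M : R := \sum_i \sum_k (`|Re (P i k)| + `|Im (P i k)|).
have le i k : `|Re (P i k)| + `|Im (P i k)| <= M.
  rewrite /M (bigD1 i)//= (bigD1 k)//= -addrA lerDl addr_ge0//.
    by apply: sumr_ge0 => ? _; rewrite addr_ge0.
  by apply: sumr_ge0 => ? _; apply: sumr_ge0 => ? _; rewrite addr_ge0.
exists (M + 1) => [|i k].
  rewrite ltr_pwDr// sumr_ge0// => i _; apply: sumr_ge0 => k _.
  by rewrite addr_ge0.
have := le i k; have := normr_ge0 (Re (P i k)); have := normr_ge0 (Im (P i k)).
by split; lra.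
Qed.

Lemma ler_norm_sumM n (a b : 'I_n -> R) (M s : R) :
  (forall i, `|a i| <= M) -> (forall i, `|b i| <= s) ->
  `|\sum_i a i * b i| <= n%:R * (M * s).
Proof.
move=> aM bs; apply: le_trans (ler_norm_sum _ _ _) _.
have -> : n%:R * (M * s) = \sum_(i < n) M * s.
  by rewrite sumr_const card_ord mulr_natl.
by apply: ler_sum => i _; rewrite normrM ler_pM.
Qed.

(** The weighted sum of squares [V] satisfies $V'\le-(a+b)V+Ke^{-2bt}$ for large times and some
    constant $K$, and $2b<a+b$, so [V] has rate [b + b] and each coordinate has rate [b]. *)
Lemma perturbed_linear_decay n (A : 'M[R]_n) (y g : 'I_n -> R -> R) (a b T : R) :
  (0 < n)%N -> 0 < b -> b < a ->
  (forall x, complex_eigenvalue A x -> a <= Re x) ->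
  (forall i t, T < t -> is_derive t (1 : R) (y i) (g i t - \sum_k A i k * y k t)) ->
  (forall e, 0 < e -> exists T' K, forall t, T' <= t ->
    forall i s, (forall k, `|y k t| <= s) ->
      `|g i t| <= e * s + K * expR (- (b * t))) ->
  forall i, decay b (y i).
Proof.
move=> n0 b0 ba Aa dy gsmall.
have [P [Q [B [QP PA _ Btrig Beig]]]] := triangularization A n0.
have [M1 M10 M1P] := complex_entries_bounded P.
have [M2 M20 M2Q] := complex_entries_bounded Q.
pose N : R := n%:R; have N0 : 0 < N by rewrite ltr0n.
(* Of the total loss [(2 * N + 2) * eta = a - b], the share [(2 * N + 1) * eta] comes from the
   Lyapunov inequality and [eta] from the perturbation. *)
pose eta := (a - b) / (2 * N + 2).
have eta0 : 0 < eta by rewrite divr_gt0 ?subr_gt0//; lra.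
have [M3 M30 M3B] := complex_entries_bounded B.
pose del := Num.min 1 (eta ^+ 2 / (2 * M3 ^+ 2)).
have M3sq : 0 < 2 * M3 ^+ 2 by apply: mulr_gt0 => //; exact: exprn_gt0.
have del0 : 0 < del by rewrite lt_min ltr01 /= divr_gt0// exprn_gt0.
have del1 : del <= 1 by rewrite ge_min lexx.
have sqr_normr (x : R) : `|x| ^+ 2 = x ^+ 2 by rewrite real_normK ?num_real.
have csq_le (x : C) (m : R) : `|Re x| <= m -> `|Im x| <= m -> csq x <= 2 * m ^+ 2.
  move=> h1 h2; rewrite /csq -[Re x ^+ 2]sqr_normr -[Im x ^+ 2]sqr_normr.
  have := normr_ge0 (Re x); have := normr_ge0 (Im x); nra.
have Bdel i k : del * csq (B i k) <= eta ^+ 2.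
  have [h1 h2] := M3B i k.
  apply: (@le_trans _ _ (del * (2 * M3 ^+ 2))).
    by rewrite ler_wpM2l ?csq_le// ltW.
  by rewrite -ler_pdivlMr// ge_min lexx orbT.
pose Z i t := \sum_k P i k * (y k t)%:C.
pose H i t := \sum_k P i k * (g k t)%:C.
pose V t := \sum_(i < n) del ^+ i * csq (Z i t).
have V0 t : 0 <= V t.
  by apply: sumr_ge0 => i _; rewrite mulr_ge0 ?csq_ge0// exprn_ge0// ltW.
have dZ i t : T < t -> is_cderive t (Z i) (H i t - \sum_k B i k * Z k t).
  move=> Tt; apply: is_cderive_eq.
    by apply: is_cderive_sum => k; apply: is_cderiveZ; apply: is_cderive_real;
      exact: dy.
  rewrite -(mulmx_sum (fun l => (y l t)%:C) i PA) -sumrB; apply: eq_bigr => k _.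
  rewrite rmorphB rmorph_sum /= mulrBr; congr (_ - _ * _).
  by apply: eq_bigr => l _; rewrite rmorphM mxE.
have dV t : T < t -> is_derive t (1 : R) V
    (\sum_(i < n) del ^+ i * (2 * cdot (Z i t) (H i t - \sum_k B i k * Z k t))).
  move=> Tt; apply: is_derive_sum_fun => i; apply: is_deriveZ_fun.
  have [d1 d2] := dZ i t Tt.
  have -> : (fun s => csq (Z i s)) =
      fun s => Re (Z i s) * Re (Z i s) + Im (Z i s) * Im (Z i s).
    by apply/funext => s; rewrite /csq !expr2.
  apply: is_derive_eq (is_deriveD_fun (is_deriveM_fun d1 d1) (is_deriveM_fun d2 d2)) _.
  by rewrite /cdot; ring.
(* All weights are at least [del ^+ n], so [s t] bounds every coordinate of [Z] at time [t]. *)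
pose s t := Num.sqrt (V t / del ^+ n).
have deln0 : 0 < del ^+ n by rewrite exprn_gt0.
have s0 t : 0 <= s t by exact: sqrtr_ge0.
have s2 t : s t ^+ 2 = V t / del ^+ n by rewrite sqr_sqrtr// divr_ge0// ltW.
have Zs i t : `|Re (Z i t)| <= s t /\ `|Im (Z i t)| <= s t.
  have csqV : csq (Z i t) <= V t / del ^+ n.
    rewrite ler_pdivlMr// mulrC; apply: (@le_trans _ _ (del ^+ i * csq (Z i t))).
      rewrite ler_wpM2r ?csq_ge0//; apply: ler_wiXn2l; rewrite ?(ltW del0)//.
      exact: ltnW.
    rewrite /V (bigD1 i)//= lerDl; apply: sumr_ge0 => k _.
    by rewrite mulr_ge0 ?csq_ge0// exprn_ge0// ltW.
  by split; rewrite -(@ler_pXn2r _ 2)// ?nnegrE// s2 (le_trans _ csqV)//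
    sqr_normr /csq ?lerDl ?lerDr sqr_ge0.
pose M4 := 2 * N * M2.
have M40 : 0 < M4 by rewrite !mulr_gt0.
have ys k t : `|y k t| <= M4 * s t.
  have -> : y k t = \sum_i Re (Q k i) * Re (Z i t) - \sum_i Im (Q k i) * Im (Z i t).
    have /(congr1 Re) /= <- := mulmx1_sum (fun l => (y l t)%:C) k QP.
    by rewrite Re_sum -sumrB; apply: eq_bigr => i _; rewrite ReM.
  apply: le_trans (ler_normB _ _) _.
  have := ler_norm_sumM (fun i => (M2Q k i).1) (fun i => (Zs i t).1).
  have := ler_norm_sumM (fun i => (M2Q k i).2) (fun i => (Zs i t).2).
  by rewrite /M4 -/N; lra.
(* With the tolerance [eta / L], the part of the perturbation proportional to [s] contributes
   [eta ^+ 2 * V t * ((L - 1) / L ^+ 2)], which is at most [eta ^+ 2 * V t]. *)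
pose L := 4 * N ^+ 3 * M1 ^+ 2 * M4 ^+ 2 / del ^+ n + 1.
have L1 : 1 <= L.
  by rewrite lerDr divr_ge0 ?mulr_ge0 ?exprn_ge0// ltW.
have L0 : 0 < L by exact: lt_le_trans L1.
have [T' [K gK]] := gsmall (eta / L) (divr_gt0 eta0 L0).
pose K' := 4 * N ^+ 3 * M1 ^+ 2 * K ^+ 2.
have HV t : T' <= t -> \sum_(i < n) del ^+ i * csq (H i t) <=
    eta ^+ 2 * V t + K' * expR (- ((b + b) * t)).
  move=> T't; pose G := eta / L * (M4 * s t) + K * expR (- (b * t)).
  have gG i : `|g i t| <= G by apply: gK => // k; exact: ys.
  have Hi i : csq (H i t) <= 2 * (N * (M1 * G)) ^+ 2.
    apply: csq_le.
    - rewrite /H Re_sum (eq_bigr (fun k => Re (P i k) * g k t)); last first.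
        by move=> k _; rewrite ReM /= mulr0 subr0.
      exact: ler_norm_sumM (fun k => (M1P i k).1) gG.
    - rewrite /H Im_sum (eq_bigr (fun k => Im (P i k) * g k t)); last first.
        by move=> k _; rewrite ImM /= mulr0 add0r.
      exact: ler_norm_sumM (fun k => (M1P i k).2) gG.
  apply: (@le_trans _ _ (\sum_(i < n) 2 * (N * (M1 * G)) ^+ 2)).
    apply: ler_sum => i _; apply: le_trans (Hi i).
    by rewrite ler_piMl ?csq_ge0// exprn_ile1// ltW.
  rewrite sumr_const card_ord -[_ *+ n]mulr_natl -/N.
  have E2 : expR (- ((b + b) * t)) = expR (- (b * t)) ^+ 2.
    by rewrite expr2 -expRD mulrDl opprD.
  have G2 : G ^+ 2 <= 2 * ((eta / L) ^+ 2 * M4 ^+ 2 * (V t / del ^+ n)) +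
      2 * (K ^+ 2 * expR (- (b * t)) ^+ 2).
    rewrite -s2 /G; set p := eta / L; set q := expR _.
    by have := sqr_ge0 (p * (M4 * s t) - K * q); lra.
  have N3 : 0 <= 2 * N ^+ 3 * M1 ^+ 2 by rewrite !mulr_ge0 ?exprn_ge0// ltW.
  have -> : N * (2 * (N * (M1 * G)) ^+ 2) = 2 * N ^+ 3 * M1 ^+ 2 * G ^+ 2 by ring.
  apply: le_trans (ler_wpM2l N3 G2) _.
  rewrite E2 /K' mulrDr; apply: lerD; last first.
    by rewrite le_eqVlt; apply/orP; left; apply/eqP; ring.
  have -> : 2 * N ^+ 3 * M1 ^+ 2 * (2 * ((eta / L) ^+ 2 * M4 ^+ 2 * (V t / del ^+ n))) =
      (eta ^+ 2 * V t) * ((L - 1) / L ^+ 2).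
    rewrite /L addrK -/L; field; apply/andP; split; exact: lt0r_neq0.
  apply: ler_piMr; first by rewrite mulr_ge0 ?sqr_ge0.
  rewrite ler_pdivrMr ?exprn_gt0// mul1r.
  have : 0 <= (L - 1) * L by rewrite mulr_ge0 ?subr_ge0// (ltW L0).
  by move: (L) => l; lra.
have decV : decay (b + b) V.
  apply: (@gronwall_decay V _ (a + b) (b + b) (K' / eta) (Num.max T T')).
  - by rewrite ltrD2r.
  - by move=> t; rewrite gt_max => /andP[Tt _]; exact: dV.
  - move=> t; rewrite gt_max => /andP[Tt T't].
    apply: le_trans (lyapunov_ineq (fun i => Z i t) (fun i => H i t)
      eta0 del0 del1 Btrig (fun i => Aa _ (Beig i)) Bdel) _.
    have hV : (\sum_(i < n) del ^+ i * csq (H i t)) / eta <=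
        eta * V t + K' / eta * expR (- ((b + b) * t)).
      rewrite ler_pdivrMr//; apply: le_trans (HV t (ltW T't)) _.
      rewrite le_eqVlt; apply/orP; left; apply/eqP; field; exact: lt0r_neq0.
    have abE : a = b + eta * (2 * N + 2).
      by rewrite /eta divfK ?subrKC// lt0r_neq0//; lra.
    rewrite -/(V t) -/N; move: hV; rewrite abE.
    move: (_ / eta) (K' / eta * _) (V t) (N) => X E v m; lra.
  - exact: V0.
move=> i; apply: decay_sqrt.
apply: le_decay (decayZ (M4 ^+ 2 / del ^+ n) decV) _; exists 0 => t _.
have -> : M4 ^+ 2 / del ^+ n * V t = (M4 * s t) ^+ 2.
  by rewrite [RHS]exprMn s2; ring.
by rewrite !normrX ler_pXn2r ?nnegrE// (le_trans (ys i t))// ler_norm.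
Qed.

End Lyapunov.

(** * Real S-polynomials and finite sums of their products with exponentials *)

Section ExponentialSums.
Context {R : realType}.
Local Open Scope complex_scope.
Local Notation C := R[i].
Local Notation Re := (@complex.Re R).
Local Notation Im := (@complex.Im R).
Implicit Types (s phi psi : R -> R) (mu : nat -> R) (N k : nat).

Definition sp s := csp (fun t => (s t)%:C).

Lemma sp_cst (c : R) : sp (fun=> c). Proof. exact: csp_cst. Qed.

Lemma spD s s' : sp s -> sp s' -> sp (fun t => s t + s' t).
Proof. by move=> h h'; apply: csp_eq (cspD h h') _ => t; rewrite rmorphD. Qed.

Lemma spM s s' : sp s -> sp s' -> sp (fun t => s t * s' t).
Proof. by move=> h h'; apply: csp_eq (cspM h h') _ => t; rewrite rmorphM. Qed.

Lemma sp_decay s (e : R) : 0 < e -> sp s -> decay (- e) s.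
Proof. by move=> e0 /(cdecay_csp e0)[]. Qed.

Lemma S_polynomial_sp n (g : R -> 'cV[R]_n) i :
  S_polynomial g -> sp (fun t => g t i 0).
Proof.
move=> [N [h [hm gE]]]; rewrite /sp.
under eq_fun do rewrite gE summxE rmorph_sum.
apply: csp_sum => j _; have [m [w [Z [hE|hE]]]] := hm j.
- apply: csp_eq (csp_Re (csp_mono (Z i 0)%:C m w)) _ => t.
  by rewrite hE mxE /cexp !ReImE /=; congr (_%:C); rewrite [0 * t]mul0r expR0; ring.
(* The sine is the real part of $-i e^{i\omega t}$. *)
- apply: csp_eq (csp_Re (csp_mono (0 +i* (- Z i 0)) m w)) _ => t.
  by rewrite hE mxE /cexp !ReImE /=; congr (_%:C); rewrite [0 * t]mul0r expR0; ring.
Qed.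

Lemma S_polynomialD n (g h : R -> 'cV[R]_n) :
  S_polynomial g -> S_polynomial h -> S_polynomial (fun t => g t + h t).
Proof.
move=> [N [g' [gm gE]]] [M [h' [hm hE]]].
exists (N + M)%N,
  (fun i => match fintype.split i with inl j => g' j | inr j => h' j end).
split=> [i|t]; first by case: (fintype.split i).
rewrite big_split_ord gE hE /=; congr (_ + _); apply: eq_bigr => i _.
- by rewrite (unsplitK (inl i)).
- by rewrite (unsplitK (inr i)).
Qed.

Lemma S_polynomial_mono n (g : R -> 'cV[R]_n) : S_monomial g -> S_polynomial g.
Proof. by move=> gm; exists 1%N, (fun=> g); split => // t; rewrite big_ord1. Qed.

(** Stated for real parts of arbitrary complex S-polynomials, because the summands of a real-valued
    one need not be real-valued. *)
Lemma csp_S_polynomial n (u : R -> C) (Z : 'cV[R]_n) :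
  csp u -> S_polynomial (fun t => Re (u t) *: Z).
Proof.
elim=> {u} [c m w|u v _ ihu _ ihv]; last first.
  by under eq_fun do rewrite ReD scalerDl; exact: S_polynomialD.
have -> : (fun t => Re (c * (t ^+ m)%:C * cexp (0 +i* w) t) *: Z) =
    (fun t => (t ^+ m * cos (w * t)) *: (Re c *: Z) +
              (t ^+ m * sin (w * t)) *: (- Im c *: Z)).
  apply/funext => t; rewrite !scalerA -scalerDl; congr (_ *: _).
  by rewrite /cexp !ReImE /= [0 * t]mul0r expR0; ring.
by apply: S_polynomialD; apply: S_polynomial_mono; exists m, w;
  [exists (Re c *: Z); left|exists (- Im c *: Z); right].
Qed.

Lemma sp_S_polynomial n (g : R -> 'cV[R]_n) :
  (forall i, sp (fun t => g t i 0)) -> S_polynomial g.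
Proof.
move=> gsp.
have -> : g = fun t => \sum_i g t i 0 *: delta_mx i 0.
  apply/funext => t; rewrite [LHS]matrix_sum_delta; apply: eq_bigr => i _.
  by rewrite big_ord1.
elim: (index_enum _) => [|i r ihr].
  under eq_fun do rewrite big_nil.
  apply: S_polynomial_mono; exists 0%N, 0, 0; left => t.
  by rewrite scaler0.
under eq_fun do rewrite big_cons.
apply: S_polynomialD => //.
exact: (csp_S_polynomial (delta_mx i 0) (gsp i)).
Qed.

(** Sums filtered by their least admissible index. An index may occur several times and no normal
    form is kept. *)
Inductive expsum mu N : (R -> R) -> Prop :=
| expsum0 : expsum mu N (fun=> 0)
| expsum_cons k s phi : (N <= k)%N -> sp s -> expsum mu N phi ->
    expsum mu N (fun t => expR (- (mu k * t)) * s t + phi t).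

Lemma expsum_eq mu N phi psi : expsum mu N phi -> phi =1 psi -> expsum mu N psi.
Proof. by move=> h /funext <-. Qed.

Lemma expsum_term mu N k s : (N <= k)%N -> sp s ->
  expsum mu N (fun t => expR (- (mu k * t)) * s t).
Proof.
move=> Nk hs; apply: expsum_eq (expsum_cons Nk hs (expsum0 _ _)) _ => t.
by rewrite addr0.
Qed.

Lemma expsumD mu N phi psi : expsum mu N phi -> expsum mu N psi ->
  expsum mu N (fun t => phi t + psi t).
Proof.
move=> hphi hpsi; elim: hphi => {phi} [|k s phi Nk hs _ ih].
  by apply: expsum_eq hpsi _ => t; rewrite add0r.
by apply: expsum_eq (expsum_cons Nk hs ih) _ => t; rewrite addrA.
Qed.

Lemma expsumZ mu N (c : R) phi : expsum mu N phi -> expsum mu N (fun t => c * phi t).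
Proof.
elim=> {phi} [|k s phi Nk hs _ ih].
  by apply: expsum_eq (expsum0 _ _) _ => t; rewrite mulr0.
apply: expsum_eq (expsum_cons Nk (spM (sp_cst c) hs) ih) _ => t.
by rewrite mulrDr; ring.
Qed.

Lemma expsum_sum mu N (I : Type) (r : seq I) (P : pred I) (h : I -> R -> R) :
  (forall i, P i -> expsum mu N (h i)) ->
  expsum mu N (fun t => \sum_(i <- r | P i) h i t).
Proof.
move=> dh; elim: r => [|i r ihr].
  by under eq_fun do rewrite big_nil; exact: expsum0.
case Pi: (P i); under eq_fun do rewrite big_cons Pi; last by [].
by apply: expsumD => //; exact: dh.
Qed.

Lemma expsumW mu M N phi : (M <= N)%N -> expsum mu N phi -> expsum mu M phi.
Proof.
move=> MN; elim=> {phi} [|k s phi Nk hs _ ih]; first exact: expsum0.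
by apply: expsum_cons => //; exact: leq_trans Nk.
Qed.

(** The terms of index exactly [N] share one exponential, so their S-polynomials add up to [s]. *)
Lemma expsum_head mu N phi : expsum mu N phi ->
  exists2 s, sp s & expsum mu N.+1 (fun t => phi t - expR (- (mu N * t)) * s t).
Proof.
elim=> {phi} [|k s phi Nk hs _ [s' hs' ih]].
  exists (fun=> 0); first exact: sp_cst.
  by apply: expsum_eq (expsum0 _ _) _ => t; rewrite mulr0 subr0.
have [kN|Nk'] := leqP k N.
  have -> : k = N by apply/eqP; rewrite eqn_leq kN.
  exists (fun t => s t + s' t); first exact: spD.
  by apply: expsum_eq ih _ => t; ring.
exists s' => //.
by apply: expsum_eq (expsum_cons Nk' hs ih) _ => t; rewrite addrA.
Qed.

Lemma expsum_decay mu N (nu : R) phi : (forall j k, (j < k)%N -> mu j < mu k) ->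
  nu < mu N -> expsum mu N phi -> decay nu phi.
Proof.
move=> mu_incr numu; elim=> {phi} [|k s phi Nk hs _ ih]; first exact: decay0.
apply: decayD => //.
have muk : nu < mu k.
  move: Nk; rewrite leq_eqVlt => /orP[/eqP <-//|/mu_incr]; exact: lt_trans.
(* The gap [mu k - nu] absorbs the polynomial growth of [s]. *)
rewrite (_ : nu = mu k - (mu k - nu)); last by ring.
apply: decayM; first exact: decay_expR.
by apply: sp_decay => //; rewrite subr_gt0.
Qed.

(** Closure under addition gives the product of two terms an index [l], and positivity puts [l]
    strictly above both factors' indices. This gain of one index drives the whole induction. *)
Lemma expsumM mu N phi psi : (forall k, 0 < mu k) ->
  (forall j k, (j < k)%N -> mu j < mu k) ->
  (forall x x', range mu x -> range mu x' -> range mu (x + x')) ->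
  expsum mu 0 phi -> expsum mu N psi -> expsum mu N.+1 (fun t => phi t * psi t).
Proof.
move=> mu_pos mu_incr mu_add hphi hpsi.
elim: hphi => {phi} [|k s phi _ hs _ ih].
  by apply: expsum_eq (expsum0 _ _) _ => t; rewrite mul0r.
have : expsum mu N.+1 (fun t => (expR (- (mu k * t)) * s t) * psi t).
  elim: hpsi => {psi ih} [|k' s' psi Nk' hs' _ ih'].
    by apply: expsum_eq (expsum0 _ _) _ => t; rewrite mulr0.
  have [l _ lE] := mu_add (mu k) (mu k') (imageT _ _) (imageT _ _).
  have k'l : (k' < l)%N.
    rewrite ltnNge; apply/negP => lk'.
    have : mu l <= mu k'.
      by move: lk'; rewrite leq_eqVlt => /orP[/eqP ->//|/mu_incr/ltW].
    by rewrite lE; have := mu_pos k; lra.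
  have Nl : (N < l)%N by exact: leq_ltn_trans k'l.
  apply: expsum_eq (expsum_cons Nl (spM hs hs') ih') _ => t.
  by rewrite lE mulrDl opprD expRD; ring.
by move=> h; apply: expsum_eq (expsumD h ih) _ => t; rewrite mulrDl.
Qed.

End ExponentialSums.

(** * Homogeneous polynomials evaluated along families of functions *)

Section PolynomialMaps.
Context {R : realType}.

(** Writing a monomial as a product over a list with repetitions allows induction on the degree. *)
Lemma multinom_prod_seq n (m : mpoly.multinom n) :
  exists2 l : seq 'I_n, size l = mpoly.mdeg m &
    forall v : 'I_n -> R, \prod_(i < n) v i ^+ m i = \prod_(j <- l) v j.
Proof.
exists (flatten [seq nseq (m i) i | i <- enum 'I_n]).
  rewrite size_flatten /shape -map_comp sumnE big_map mpoly.mdegE big_enum.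
  by apply: eq_bigr => i _ /=; rewrite size_nseq.
move=> v; rewrite big_flatten big_map big_enum; apply: eq_bigr => i _.
by rewrite big_nseq; elim: (m i) => //= k <-; rewrite exprS.
Qed.

(* [cA] holds the arguments, [cB] their differences, and [cC] is the smaller
   class reached because every monomial has a second factor in [cA]. *)
Lemma homog_meval_diff (cA cB cC : (R -> R) -> Prop) n m (p : mpoly.mpoly n R)
    (x y : 'I_n -> R -> R) :
  (forall u v, cA u -> cA v -> cA (fun t => u t * v t)) ->
  (forall u v, cB u -> cA v -> cC (fun t => u t * v t)) ->
  (forall u v, cC u -> cA v -> cC (fun t => u t * v t)) ->
  cC (fun=> 0) ->
  (forall u v, cC u -> cC v -> cC (fun t => u t + v t)) ->
  (forall c u, cC u -> cC (fun t => c * u t)) ->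
  (forall i, cA (x i)) -> (forall i, cA (y i)) ->
  (forall i, cB (fun t => x i t - y i t)) ->
  (2 <= m)%N -> p \is mpoly.ishomog1 m (@mpoly.mdeg n) ->
  cC (fun t => mpoly.meval (x^~ t) p - mpoly.meval (y^~ t) p).
Proof.
move=> AA BA CA C0 CD CZ xA yA xyB m2 /mpoly.dhomogP hp.
have prodA i (l : seq 'I_n) : cA (fun t => \prod_(j <- i :: l) x j t).
  elim: l i => [|k l ih] i.
    by under eq_fun do rewrite big_seq1; exact: xA.
  by under eq_fun do rewrite big_cons; apply: AA.
(* Telescoping by $x_iX-y_iY=(x_i-y_i)X+(X-Y)y_i$; with at least two factors, every difference meets
   a further factor. *)
have prodC i k (l : seq 'I_n) : cC (fun t =>
    \prod_(j <- [:: i, k & l]) x j t - \prod_(j <- [:: i, k & l]) y j t).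
  elim: l i k => [|k' l ih] i k.
    have -> : (fun t => \prod_(j <- [:: i; k]) x j t - \prod_(j <- [:: i; k]) y j t) =
        fun t => (x i t - y i t) * x k t + (x k t - y k t) * y i t.
      by apply/funext => t; rewrite !big_cons !big_nil; ring.
    by apply: CD; apply: BA.
  have -> : (fun t => \prod_(j <- [:: i, k, k' & l]) x j t -
      \prod_(j <- [:: i, k, k' & l]) y j t) =
      fun t => (x i t - y i t) * \prod_(j <- [:: k, k' & l]) x j t +
        (\prod_(j <- [:: k, k' & l]) x j t - \prod_(j <- [:: k, k' & l]) y j t) * y i t.
    apply/funext => t; rewrite !(big_cons _ _ i).
    by move: (\prod_(j <- _) _) (\prod_(j <- _) _) => a b; ring.
  by apply: CD; [apply: BA|apply: CA].
have -> : (fun t => mpoly.meval (x^~ t) p - mpoly.meval (y^~ t) p) =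
    fun t => \sum_(a <- mpoly.msupp p) mpoly.mcoeff a p *
      (\prod_(i < n) x i t ^+ a i - \prod_(i < n) y i t ^+ a i).
  apply/funext => t; rewrite !mpoly.mevalE -sumrB.
  by apply: eq_bigr => a _; rewrite mulrBr.
(* The induction on the list of monomials must remember that they lie in the support, which is what
   fixes their degree. *)
have : {subset mpoly.msupp p <= mpoly.msupp p} by [].
elim: {1 3}(mpoly.msupp p : seq _) => [|a r ih] sub.
  by under eq_fun do rewrite big_nil; exact: C0.
under eq_fun do rewrite big_cons.
apply: CD; last by apply: ih => b br; apply: sub; rewrite inE br orbT.
apply: CZ; have [l szl lE] := multinom_prod_seq a.
under eq_fun do rewrite !lE.
move: szl; rewrite (hp a); last by apply: sub; rewrite inE eqxx.
by case: l {lE} => [|i [|k l]] /= mE; move: m2; rewrite -mE.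
Qed.

(** A monomial of degree [m.+1] takes [m] multiplications, each of which raises the least index. *)
Lemma homog_meval_expsum (mu : nat -> R) n m (p : mpoly.mpoly n R)
    (x : 'I_n -> R -> R) :
  (forall k, 0 < mu k) -> (forall j k, (j < k)%N -> mu j < mu k) ->
  (forall x x', range mu x -> range mu x' -> range mu (x + x')) ->
  (forall i, expsum mu 0 (x i)) ->
  p \is mpoly.ishomog1 m.+1 (@mpoly.mdeg n) ->
  expsum mu m (fun t => mpoly.meval (x^~ t) p).
Proof.
move=> mu_pos mu_incr mu_add hx /mpoly.dhomogP hp.
under eq_fun do rewrite mpoly.mevalE big_seq.
apply: expsum_sum => a /hp ma; apply: expsumZ.
have [l szl lE] := multinom_prod_seq a; under eq_fun do rewrite lE.
move: szl; rewrite ma; elim: l m {lE hp a ma} => [//|i [|k l] ih] m [<-].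
  by under eq_fun do rewrite big_seq1; exact: hx.
under eq_fun do rewrite big_cons.
by apply: expsumM => //; exact: ih.
Qed.

End PolynomialMaps.

(** * The Euclidean norm compared with coordinatewise bounds *)

Section EuclideanNorm.
Context {R : realType}.

Lemma ler_coord_enorm n (x : 'cV[R]_n) i : `|x i 0| <= enorm x.
Proof.
rewrite -sqrtr_sqr ler_wsqrtr// (bigD1 i)//= lerDl sumr_ge0// => j _.
exact: sqr_ge0.
Qed.

Lemma enorm_le n (x : 'cV[R]_n) (s : R) : 0 <= s ->
  (forall i, `|x i 0| <= s) -> enorm x <= n%:R * s.
Proof.
move=> s0 xs; have ns0 : 0 <= n%:R * s by rewrite mulr_ge0.
rewrite -[leRHS]ger0_norm// -sqrtr_sqr ler_wsqrtr//.
apply: (@le_trans _ _ (\sum_(i < n) s ^+ 2)).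
  apply: ler_sum => i _; rewrite -[x i 0 ^+ 2]real_normK ?num_real//.
  by rewrite ler_pXn2r ?nnegrE.
rewrite sumr_const card_ord -[_ *+ n]mulr_natl exprMn ler_wpM2r ?sqr_ge0//.
rewrite expr2.
case: n {x xs ns0} => [|n]; first by rewrite mul0r.
by rewrite ler_peMl// ler1n.
Qed.

Lemma bigO_decay n (u : R -> 'cV[R]_n) (nu : R) i :
  bigO_infty u (fun t => expR (- (nu * t))) -> decay nu (fun t => u t i 0).
Proof.
move=> [T [C [_ _ H]]]; exists T, C => t Tt.
exact: le_trans (ler_coord_enorm _ _) (H t Tt).
Qed.

Lemma decay_bigO n (u : R -> 'cV[R]_n) (nu : R) :
  (forall i, decay nu (fun t => u t i 0)) ->
  bigO_infty u (fun t => expR (- (nu * t))).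
Proof.
move=> du.
have /decayE[T [C [T0 C0 H]]] : decay nu (fun t => \sum_i `|u t i 0|).
  apply: decay_sum => i _; apply: le_decay (du i) _; exists 0 => t _.
  by rewrite normr_id.
(* The summand 1 keeps the constant positive even for [n = 0]. *)
exists T, (n%:R * C + 1); split=> //; first by rewrite ltr_wpDl// mulr_ge0// ltW.
move=> t Tt; have := H t Tt; rewrite ger0_norm; last by apply: sumr_ge0.
move=> uC; apply: (@le_trans _ _ (n%:R * (C * expR (- (nu * t))))).
  apply: enorm_le => [|i]; first by rewrite mulr_ge0 ?expR_ge0// ltW.
  apply: le_trans uC; rewrite (bigD1 i)//= lerDl; exact: sumr_ge0.
by rewrite mulrA ler_wpM2r ?expR_ge0// lerDl.
Qed.

Lemma decay_enorm n (u : R -> 'cV[R]_n) (nu : R) :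
  (forall i, decay nu (fun t => u t i 0)) -> decay nu (fun t => enorm (u t)).
Proof.
move=> /decay_bigO[T [C [_ _ H]]]; exists T, C => t Tt.
by rewrite ger0_norm ?H// sqrtr_ge0.
Qed.

End EuclideanNorm.

(** * Taylor polynomials of [G] along decaying functions *)

Section TaylorExpansion.
Context {R : realType}.

Lemma decayX (nu : R) (u : R -> R) k : decay nu u ->
  decay (k%:R * nu) (fun t => u t ^+ k).
Proof.
move=> du; elim: k => [|k ih].
  by rewrite mul0r; apply: decay_bounded => t; rewrite expr0 normr1.
rewrite -natr1 mulrDl mul1r addrC; under eq_fun do rewrite exprS.
exact: decayM.
Qed.

Lemma decay_small (nu : R) (u : R -> R) (e : R) : 0 < nu -> 0 < e -> decay nu u ->
  exists T, forall t, T <= t -> `|u t| <= e.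
Proof.
move=> nu0 e0 [T [C H]]; have [T' H'] := expR_eventually_small C nu0 e0.
exists (Num.max T T') => t; rewrite ge_max => /andP[Tt T't].
exact: le_trans (H t Tt) (H' t T't).
Qed.


Lemma powR_le_exprn (x d : R) k : 0 <= x -> x <= 1 -> 0 < d ->
  x `^ (k%:R + d) <= x ^+ k.
Proof.
rewrite le_eqVlt => /orP[/eqP <-|x0] x1 d0.
  by rewrite powR0 ?exprn_ge0// gt_eqF// ltr_wpDl.
rewrite -powR_mulrn ?(ltW x0)//; apply: ger_powR; first by rewrite x0.
by rewrite lerDl ltW.
Qed.

Lemma homog_map_diff (cA cB cC : (R -> R) -> Prop) n m (G : 'cV[R]_n -> 'cV[R]_n)
    (x y : R -> 'cV[R]_n) i :
  (forall u v, cA u -> cA v -> cA (fun t => u t * v t)) ->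
  (forall u v, cB u -> cA v -> cC (fun t => u t * v t)) ->
  (forall u v, cC u -> cA v -> cC (fun t => u t * v t)) ->
  cC (fun=> 0) ->
  (forall u v, cC u -> cC v -> cC (fun t => u t + v t)) ->
  (forall c u, cC u -> cC (fun t => c * u t)) ->
  (forall i, cA (fun t => x t i 0)) -> (forall i, cA (fun t => y t i 0)) ->
  (forall i, cB (fun t => x t i 0 - y t i 0)) ->
  (2 <= m)%N -> homogeneous_polynomial_map m G ->
  cC (fun t => G (x t) i 0 - G (y t) i 0).
Proof.
move=> AA BA CA C0 CD CZ xA yA xyB m2 [p [hp GE]].
under eq_fun do rewrite !GE.
exact: (@homog_meval_diff _ cA cB cC n m (p i)
  (fun j t => x t j 0) (fun j t => y t j 0)).
Qed.

Lemma homog_map_expsum (mu : nat -> R) n m (G : 'cV[R]_n -> 'cV[R]_n)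
    (x : R -> 'cV[R]_n) i :
  (forall k, 0 < mu k) -> (forall j k, (j < k)%N -> mu j < mu k) ->
  (forall x x', range mu x -> range mu x' -> range mu (x + x')) ->
  (forall i, expsum mu 0 (fun t => x t i 0)) ->
  homogeneous_polynomial_map m.+1 G ->
  expsum mu m (fun t => G (x t) i 0).
Proof.
move=> mu_pos mu_incr mu_add hx [p [hp GE]].
under eq_fun do rewrite !GE.
exact: (@homog_meval_expsum _ mu n m (p i) (fun j t => x t j 0)).
Qed.

Lemma homog_map_bound n m (G : 'cV[R]_n -> 'cV[R]_n) :
  homogeneous_polynomial_map m G ->
  exists2 K : R, 0 <= K & forall (x : 'cV[R]_n) (s : R) i, (forall k, `|x k 0| <= s) ->
    `|G x i 0| <= K * s ^+ m.
Proof.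
move=> [p [hp GE]].
pose K i := \sum_(a <- mpoly.msupp (p i)) `|mpoly.mcoeff a (p i)|.
have K0 i : 0 <= K i by apply: sumr_ge0.
exists (\sum_i K i) => [|x s i xs]; first exact: sumr_ge0.
have s0 : 0 <= s by exact: le_trans (normr_ge0 _) (xs i).
apply: (@le_trans _ _ (K i * s ^+ m)); last first.
  by rewrite ler_wpM2r ?exprn_ge0// (bigD1 i)//= lerDl sumr_ge0.
rewrite GE mpoly.mevalE mulr_suml; apply: le_trans (ler_norm_sum _ _ _) _.
rewrite big_seq [leRHS]big_seq; apply: ler_sum => a ap.
rewrite normrM ler_wpM2l//; have [l szl ->] := @multinom_prod_seq R _ a.
have /mpoly.dhomogP/(_ _ ap) am := hp i.
have -> : m = size l by rewrite szl; exact: esym am.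
elim: l {szl} => [|k l ih]; first by rewrite big_nil normr1.
by rewrite big_cons normrM exprS ler_pM.
Qed.

Lemma taylor_remainder_decay n (G : 'cV[R]_n -> 'cV[R]_n)
    (Gm : nat -> 'cV[R]_n -> 'cV[R]_n) (x : R -> 'cV[R]_n) (nu : R) N i :
  (exists delta : R, 0 < delta /\ exists r C : R, [/\ 0 < r, 0 < C &
     forall z, enorm z < r -> enorm (G z - \sum_(2 <= m < N.+1) Gm m z)
       <= C * enorm z `^ (N%:R + delta)]) ->
  0 < nu -> (forall k, decay nu (fun t => x t k 0)) ->
  decay (N%:R * nu) (fun t => G (x t) i 0 - \sum_(2 <= m < N.+1) Gm m (x t) i 0).
Proof.
move=> [d [d0 [r [C [r0 C0 GC]]]]] nu0 dx.
have dn := decay_enorm dx.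
have e0 : 0 < Num.min (r / 2) 1 by rewrite lt_min ltr01 divr_gt0.
have [T xT] := decay_small nu0 e0 dn.
apply: le_decay (decayZ C (decayX N dn)) _; exists T => t Tt.
have := xT t Tt; rewrite le_min ger0_norm ?sqrtr_ge0// => /andP[xr x1].
have -> : G (x t) i 0 - \sum_(2 <= m < N.+1) Gm m (x t) i 0 =
    (G (x t) - \sum_(2 <= m < N.+1) Gm m (x t)) i 0.
  by rewrite !mxE summxE.
apply: le_trans (ler_coord_enorm _ _) _.
apply: le_trans (GC _ _) _; first by lra.
apply: le_trans (ler_norm _); rewrite ler_wpM2l ?(ltW C0)//.
by apply: powR_le_exprn; rewrite ?sqrtr_ge0.
Qed.

(** The expansion at order 2: near 0 both the quadratic part and the remainder are quadratically
    small. *)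
Lemma taylor_quadratic_bound n (G : 'cV[R]_n -> 'cV[R]_n) : assumption_G G ->
  exists r K : R, [/\ 0 < r, 0 <= K & forall (x : 'cV[R]_n) (s : R) i, s <= r ->
    (forall k, `|x k 0| <= s) -> `|G x i 0| <= K * s ^+ 2].
Proof.
move=> [_ [Gm [Gmh]]] /(_ 2 (leqnn 2))[d [d0 [r [C [r0 C0 GC]]]]].
have [K2 K20 GK2] := homog_map_bound (Gmh 2 (leqnn 2)).
pose N : R := n%:R + 1; have N0 : 0 < N by rewrite ltr_wpDl.
(* Division by [N] converts a bound on coordinates into one on the Euclidean norm. *)
pose r' := Num.min (r / 2) 1 / N.
have r'0 : 0 < r' by rewrite divr_gt0// lt_min ltr01 divr_gt0.
exists r', (C * N ^+ 2 + K2); split=> // [|x s i sr xs].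
  by rewrite addr_ge0// mulr_ge0 ?sqr_ge0// ltW.
have s0 : 0 <= s by exact: le_trans (normr_ge0 _) (xs i).
have xN : enorm x <= N * s.
  by apply: le_trans (enorm_le s0 xs) _; rewrite ler_wpM2r// lerDl.
have : N * s <= Num.min (r / 2) 1 by rewrite mulrC -ler_pdivlMr.
rewrite le_min => /andP[Nr N1].
have -> : G x i 0 = (G x - \sum_(2 <= m < 3) Gm m x) i 0 + Gm 2 x i 0.
  by rewrite big_nat1 !mxE subrK.
apply: le_trans (ler_normD _ _) _; rewrite mulrDl; apply: lerD; last exact: GK2.
apply: le_trans (ler_coord_enorm _ _) _.
apply: le_trans (GC _ _) _; first by lra.
rewrite -mulrA ler_wpM2l ?(ltW C0)// -exprMn.
apply: le_trans (powR_le_exprn _ _ _ _) _; rewrite ?sqrtr_ge0//.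
  exact: le_trans N1.
by rewrite ler_pXn2r ?nnegrE ?sqrtr_ge0// mulr_ge0// ltW.
Qed.

End TaylorExpansion.

(** * The construction of the expansion, term by term *)

Section AsymptoticExpansion.
Context {R : realType} (n : nat) (A : 'M[R]_n)
  (G : 'cV[R]_n -> 'cV[R]_n) (f y : R -> 'cV[R]_n) (T0 : R)
  (mu : nat -> R) (fh : nat -> R -> 'cV[R]_n).
Context (n_gt0 : (0 < n)%N)
  (y_ode : forall i t, T0 < t -> is_derive t (1 : R) (fun s => y s i 0)
  (G (y t) i 0 + f t i 0 - \sum_k A i k * y t k 0))
  (mu_pos : forall k, 0 < mu k)
  (mu_incr : forall j k, (j < k)%N -> mu j < mu k)
  (mu_add : forall x x', range mu x -> range mu x' -> range mu (x + x'))
  (mu_spec : forall x, complex_eigenvalue A x -> range mu (complex.Re x))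
  (fhP : expansion f fh mu).

Lemma mu_le j k : (j <= k)%N -> mu j <= mu k.
Proof. by rewrite leq_eqVlt => /orP[/eqP ->//|/mu_incr/ltW]. Qed.

(** The sum [mu k + mu 0] is itself an exponent beyond [mu k], so consecutive gaps never exceed
    [mu 0]. *)
Lemma mu_succ_le k : mu k.+1 <= mu k + mu 0.
Proof.
have [l _ lE] := mu_add (imageT mu k) (imageT mu 0%N).
rewrite -lE; apply: mu_le; rewrite ltnNge; apply/negP => /mu_le.
by rewrite lE; have := mu_pos 0; lra.
Qed.

Lemma forcing_decay (b : R) i : b < mu 0 -> decay b (fun t => f t i 0).
Proof.
move=> b0; have [fhs] := fhP; move=> /(_ 0%N)[nu [munu /bigO_decay df]].
have d1 : decay b (fun t => expR (- (mu 0 * t)) * fh 0 t i 0).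
  apply: (@expsum_decay _ mu 0) => //; apply: expsum_term => //.
  exact: S_polynomial_sp.
have nub : b <= nu by rewrite ltW// (lt_trans b0).
apply: eventually_decay (decayD (decayW nub (df i)) d1) _; exists 0 => t _.
by rewrite big_ord1 !mxE subrK.
Qed.

Lemma solution_decay (b : R) : assumption_G G -> y t @[t --> +oo] --> (0 : 'cV[R]_n) ->
  0 < b -> b < mu 0 -> forall i, decay b (fun t => y t i 0).
Proof.
move=> hG y0 b0 bmu.
apply: (@perturbed_linear_decay _ n A (fun i t => y t i 0)
  (fun i t => G (y t) i 0 + f t i 0) (mu 0) b T0) => //.
  (* Real parts of eigenvalues are exponents, and [mu 0] is the least exponent. *)
  by move=> x /mu_spec[k _ <-]; exact: mu_le.
move=> e e0; have [r [K [r0 K0 GK]]] := taylor_quadratic_bound hG.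
(* Within [rho] the quadratic bound on [G] applies and amounts to at most [e] times the size of the
   argument. *)
pose rho := Num.min r (e / (K + 1)).
have rho0 : 0 < rho by rewrite lt_min r0 divr_gt0// ltr_wpDl.
have [T yT] : exists T, forall t, T <= t -> forall k, `|y t k 0| <= rho.
  have /cvgrPdist_le/(_ _ rho0)[M [_ yM]] := y0.
  exists (M + 1) => t Mt k; apply: (@le_trans _ _ `|0 - y t|); last first.
    by apply: yM; rewrite (lt_le_trans _ Mt)// ltrDl.
  rewrite sub0r normrN [leRHS]/Num.Def.normr/= mx_normrE.
  by apply: le_trans; last exact: (le_bigmax _ _ (k, 0)).
have df i : decay b (fun t => f t i 0) by exact: forcing_decay.
have /decayE[T' [C [_ _ fC]]] : decay b (fun t => enorm (f t)) by exact: decay_enorm.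
exists (Num.max T T'), C => t; rewrite ge_max => /andP[Tt T't] i s ys.
apply: le_trans (ler_normD _ _) _; apply: lerD; last first.
  apply: le_trans (ler_coord_enorm _ _) _; apply: le_trans (fC t T't).
  exact: ler_norm.
have s0 : 0 <= s by exact: le_trans (normr_ge0 _) (ys i).
(* Both [s] and [rho] bound the coordinates of [y t]: one factor of the square is estimated by [s],
   the other by [rho]. *)
have m0 : 0 <= Num.min s rho by rewrite le_min s0 ltW.
apply: le_trans (GK (y t) (Num.min s rho) i _ _) _.
- by rewrite ge_min /rho ge_min lexx orbT.
- by move=> k; rewrite le_min ys yT.
have h1 : Num.min s rho <= s by rewrite ge_min lexx.
have h2 : K * Num.min s rho <= e.
  apply: (@le_trans _ _ ((K + 1) * (e / (K + 1)))); last first.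
    by rewrite mulrC divfK// gt_eqF// ltr_wpDl.
  by rewrite ler_pM ?lerDl// ge_min [rho <= _]ge_min lexx !orbT.
by rewrite expr2 mulrA ler_pM// mulr_ge0.
Qed.

(** [P] is the partial sum and [L] stands for $P'+AP$. A Taylor term of degree [m] has index at
    least [m.-1], so degrees up to [N.+1] contain everything of index [N]. The condition
    [mu N < nu + mu 0] makes the product of the error with a factor of rate close to [mu 0] decay
    faster than $e^{-\mu_N t}$. *)
Definition expansion_stage (Gm : nat -> 'cV[R]_n -> 'cV[R]_n) (N : nat)
    (P L : R -> 'cV[R]_n) : Prop :=
  [/\ forall i, expsum mu 0 (fun t => P t i 0),
    forall i t, is_derive t (1 : R) (fun s => P s i 0)
      (L t i 0 - \sum_k A i k * P t k 0),
    forall i, expsum mu N (fun t => \sum_(2 <= m < N.+2) Gm m (P t) i 0 +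
      \sum_(k < N) expR (- (mu k * t)) * fh k t i 0 - L t i 0) &
    exists nu, [/\ forall k, (k < N)%N -> mu k < nu, mu N < nu + mu 0 &
      forall i, decay nu (fun t => y t i 0 - P t i 0)]].

Lemma expansion_stage0 Gm : (forall i, decay (mu 0 / 2) (fun t => y t i 0)) ->
  expansion_stage Gm 0 (fun=> 0) (fun=> 0).
Proof.
move=> dy; split.
- by move=> i; under eq_fun do rewrite mxE; exact: expsum0.
- move=> i t; under eq_fun do rewrite mxE.
  apply: is_derive_eq (is_derive_cst _ _ _) _.
  by rewrite mxE big1 ?subr0// => k _; rewrite mxE mulr0.
- move=> i; apply: expsum_eq (expsum0 _ _) _ => t.
  by rewrite big_geq// big_ord0 mxE subr0 addr0.
- exists (mu 0 / 2); split=> //; first by have := mu_pos 0; lra.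
  by move=> i; under eq_fun do rewrite mxE subr0; exact: dy.
Qed.

Lemma expansion_step Gm N P L :
  (forall m, (2 <= m)%N -> homogeneous_polynomial_map m (Gm m)) ->
  (forall N, (2 <= N)%N ->
    exists delta : R, 0 < delta /\
    exists r C : R, [/\ 0 < r, 0 < C &
      forall x, enorm x < r ->
        enorm (G x - \sum_(2 <= m < N.+1) Gm m x)
          <= C * enorm x `^ (N%:R + delta)]) ->
  (forall b, 0 < b -> b < mu 0 -> forall i, decay b (fun t => y t i 0)) ->
  expansion_stage Gm N P L ->
  exists q L', S_polynomial q /\
    expansion_stage Gm N.+1 (fun t => P t + expR (- (mu N * t)) *: q t) L'.
Proof.
move=> GmH GmT ydecay [PE dP DE [nu [munu muNnu dyP]]].
have [fhs fhO] := fhP; have [nuf [muNnuf /bigO_decay df]] := fhO N.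
have fsp k i : sp (fun t => fh k t i 0) by exact: S_polynomial_sp.
pose D i t := \sum_(2 <= m < N.+2) Gm m (P t) i 0 +
  \sum_(k < N) expR (- (mu k * t)) * fh k t i 0 - L t i 0.
(* [s] is the part of index [N] of the defect [D]. The forcing in [D] stops before index [N], so [r]
   adds [fh N]. *)
have [s sP] : {s : 'I_n -> R -> R & forall i, sp (s i) /\
    expsum mu N.+1 (fun t => D i t - expR (- (mu N * t)) * s i t)}.
  apply: (@choice _ _ (fun i s => sp s /\
    expsum mu N.+1 (fun t => D i t - expR (- (mu N * t)) * s t))) => i.
  by have [s] := expsum_head (DE i); exists s.
pose r i t := s i t + fh N t i 0.
have rsp i : sp (r i) by apply: spD => //; case: (sP i).
pose e t := expR (- (mu N * t)).
pose rho i t := G (y t) i 0 + f t i 0 - L t i 0 - e t * r i t.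
have muNN1 : mu N < mu N.+1 by exact: mu_incr.
(* A common rate for [y] and [P], strictly between [mu N - nu] and [mu 0]: the second entry is the
   midpoint, the first ensures positivity. *)
pose nu0 := Num.max (mu 0 / 2) ((mu N - nu + mu 0) / 2).
have nu00 : 0 < nu0 by rewrite lt_max; apply/orP; left; rewrite divr_gt0.
have nu0mu : nu0 < mu 0 by rewrite gt_max; apply/andP; split; have := mu_pos 0; lra.
have nu0nu : mu N < nu + nu0.
  suff : (mu N - nu + mu 0) / 2 <= nu0 by lra.
  by rewrite le_max lexx orbT.
have dy i : decay nu0 (fun t => y t i 0) by exact: ydecay.
have dPd i : decay nu0 (fun t => P t i 0) by exact: expsum_decay (PE i).
have [M [NM Mnu0]] : exists M : nat, (N.+2 <= M)%N /\ mu N < M%:R * nu0.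
  exists (N.+2 + (Num.truncn (mu N / nu0)).+1)%N; split; first exact: leq_addr.
  rewrite -ltr_pdivrMr// natrD; apply: (lt_le_trans (truncnS_gt _)).
  by rewrite lerDr.
(* The entries are the rates of the differences of Taylor terms, of the Taylor remainder and of the
   forcing remainder; the last one, below [mu N.+1], serves all sums of index at least [N.+1]. *)
pose nu' := Num.min (Num.min (nu + nu0) (M%:R * nu0))
  (Num.min nuf ((mu N + mu N.+1) / 2)).
have muNnu' : mu N < nu' by rewrite !lt_min nu0nu Mnu0 muNnuf /=; lra.
have expsum_nu' phi : expsum mu N.+1 phi -> decay nu' phi.
  apply: expsum_decay => //; rewrite !gt_min.
  by apply/orP; right; apply/orP; right; lra.
(* Five contributions: the Taylor remainder at [y], the change of the Taylor terms from [y] to [P],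
   the degrees above [N.+1] at [P], the forcing remainder, and the defect beyond index [N]. *)
have drho i : decay nu' (rho i).
  have d1 : decay nu' (fun t => G (y t) i 0 - \sum_(2 <= m < M.+1) Gm m (y t) i 0).
    apply: (@decayW _ (M%:R * nu0)); first by rewrite !ge_min lexx !orbT.
    apply: taylor_remainder_decay => //; apply: GmT.
    exact: leq_trans NM.
  have d2 : decay nu' (fun t => \sum_(2 <= m < M.+1) (Gm m (y t) i 0 - Gm m (P t) i 0)).
    apply: (@decayW _ (nu + nu0)); first by rewrite !ge_min lexx.
    under eq_fun do rewrite big_nat_cond.
    apply: decay_sum => m /andP[/andP[m2 _] _].
    apply: (@homog_map_diff _ (decay nu0) (decay nu) (decay (nu + nu0)) _ m) => //.
    - move=> u v du dv; apply: decayW (decayM du dv); lra.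
    - by move=> u v; exact: decayM.
    - move=> u v du dv; apply: decayW (decayM du dv); lra.
    - exact: decay0.
    - by move=> u v; exact: decayD.
    - by move=> c u; exact: decayZ.
    - exact: GmH.
  have d3 : decay nu' (fun t => \sum_(N.+2 <= m < M.+1) Gm m (P t) i 0).
    apply: expsum_nu'; under eq_fun do rewrite big_nat_cond.
    apply: expsum_sum => -[//|m] /andP[/andP[m2 _] _].
    apply: (@expsumW _ _ _ m) => //; apply: homog_map_expsum => //.
    by apply: GmH; exact: leq_trans m2.
  have d4 : decay nu' (fun t => f t i 0 -
      \sum_(k < N.+1) expR (- (mu k * t)) * fh k t i 0).
    apply: (@decayW _ nuf); first by rewrite !ge_min lexx !orbT.
    apply: eventually_decay (df i) _; exists 0 => t _.
    by rewrite !mxE summxE; congr (_ - _); apply: eq_bigr => k _; rewrite mxE.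
  have d5 : decay nu' (fun t => D i t - e t * s i t).
    by apply: expsum_nu'; case: (sP i).
  apply: eventually_decay (decayD (decayD (decayD (decayD d1 d2) d3) d4) d5) _.
  exists 0 => t _; rewrite /rho /r /D sumrB.
  rewrite (@big_cat_nat _ _ _ N.+2 2 M.+1 _ (fun m => Gm m (P t) i 0))//=; last first.
    exact: leq_trans (leqnSn _).
  by rewrite big_ord_recr /= -/(e t); ring.
have [i t Tt| | | | |x xA|q [qsp dq [nu'' munu'' decq]]] :=
  @vector_step R n A (fun i t => y t i 0 - P t i 0) r rho (mu N) nu nu' T0
    n_gt0 _ _ _ _ _ _.
- apply: is_derive_eq (is_deriveB_fun (y_ode i Tt) (dP i t)) _.
  have -> : \sum_k A i k * (y t k 0 - P t k 0) =
      \sum_k A i k * y t k 0 - \sum_k A i k * P t k 0.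
    by rewrite -sumrB; apply: eq_bigr => k _; rewrite mulrBr.
  by rewrite /rho -/(e t); ring.
- exact: rsp.
- exact: drho.
- exact: muNnu'.
- exact: dyP.
(* An eigenvalue has real part [mu k], which is below [nu] for [k < N] and at least [mu N]
   otherwise; this is where the spectrum must be among the exponents. *)
- have [k _ <-] := mu_spec xA; have [/munu|] := ltnP k N; first by left.
  by right; exact: mu_le.
(* The equation of [q] says that [e * q] has derivative [e * (r - A q)], so [L] grows by exactly
   [e * r]. *)
exists (fun t => \col_i q i t), (fun t => L t + e t *: \col_i r i t).
pose P' t := P t + e t *: \col_i q i t.
have P'E i t : P' t i 0 = P t i 0 + e t * q i t by rewrite !mxE.
have eq_expsum i : expsum mu N (fun t => e t * q i t) by apply: expsum_term.
have P'sum i : expsum mu 0 (fun t => P' t i 0).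
  under eq_fun do rewrite P'E; apply: expsumD => //.
  exact: expsumW (eq_expsum i).
split; first by apply: sp_S_polynomial => i; under eq_fun do rewrite mxE; exact: qsp.
suff : expansion_stage Gm N.+1 P' (fun t => L t + e t *: \col_i r i t) by [].
split=> //.
- move=> i t; under eq_fun do rewrite P'E.
  have de : is_derive t (1 : R) e (- mu N * e t).
    rewrite /e; under eq_fun do rewrite -mulNr.
    by rewrite -mulNr; apply: is_derive_comp_scale.
  apply: is_derive_eq (is_deriveD_fun (dP i t) (is_deriveM_fun de (dq i t))) _.
  have -> : \sum_k A i k * P' t k 0 =
      \sum_k A i k * P t k 0 + e t * \sum_k A i k * q k t.
    rewrite mulr_sumr -big_split; apply: eq_bigr => k _.
    by rewrite P'E /=; ring.
  by rewrite !mxE; ring.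
- move=> i.
  (* [P'] differs from [P] by terms of index at least [N], and in degree at least 2 each difference
     is multiplied by a further factor, so the index rises to [N.+1]. *)
  have d1 : expsum mu N.+1
      (fun t => \sum_(2 <= m < N.+3) (Gm m (P' t) i 0 - Gm m (P t) i 0)).
    under eq_fun do rewrite big_nat_cond.
    apply: expsum_sum => m /andP[/andP[m2 _] _].
    apply: (@homog_map_diff _ (expsum mu 0) (expsum mu N) (expsum mu N.+1) _ m) => //.
    - by move=> u v du dv; apply: expsumW (expsumM mu_pos mu_incr mu_add du dv).
    - move=> u v du dv; apply: expsum_eq (expsumM mu_pos mu_incr mu_add dv du) _ => t.
      by rewrite mulrC.
    - move=> u v du dv; apply: expsumW (leqnSn _) _.
      apply: expsum_eq (expsumM mu_pos mu_incr mu_add dv du) _ => t.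
      by rewrite mulrC.
    - exact: expsum0.
    - by move=> u v; exact: expsumD.
    - by move=> c u; exact: expsumZ.
    - move=> j; apply: expsum_eq (eq_expsum j) _ => t.
      by rewrite P'E; ring.
    - exact: GmH.
  have d2 : expsum mu N.+1 (fun t => Gm N.+2 (P t) i 0).
    by apply: homog_map_expsum => //; exact: GmH.
  apply: expsum_eq (expsumD (expsumD d1 d2) (sP i).2) _ => t.
  rewrite /D sumrB [\sum_(2 <= m < N.+3) Gm m (P t) i 0]big_nat_recr//=.
  by rewrite [\sum_(k < N.+1) _]big_ord_recr /= !mxE /r -/(e t); ring.
- exists nu''; split.
  + by move=> k; rewrite ltnS => /mu_le kN; exact: le_lt_trans munu''.
  + by apply: le_lt_trans (mu_succ_le N) _; rewrite ltrD2r.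
  + move=> i; apply: eventually_decay (decq i) _; exists 0 => t _.
    by rewrite P'E -/(e t); ring.
Qed.

Lemma solution_expansion : assumption_G G ->
  y t @[t --> +oo] --> (0 : 'cV[R]_n) ->
  exists qh : nat -> R -> 'cV[R]_n, expansion y qh mu.
Proof.
move=> hG y0; have [_ [Gm [GmH GmT]]] := hG.
have ydecay b : 0 < b -> b < mu 0 -> forall i, decay b (fun t => y t i 0).
  exact: solution_decay.
(* The step is turned into a function on all triples, with a dummy value where the stage property
   fails, so that the terms can be defined by recursion. *)
have [F FP] : {F : nat * (R -> 'cV[R]_n) * (R -> 'cV[R]_n) ->
    (R -> 'cV[R]_n) * (R -> 'cV[R]_n) &
    forall a, expansion_stage Gm a.1.1 a.1.2 a.2 -> S_polynomial (F a).1 /\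
      expansion_stage Gm a.1.1.+1
        (fun t => a.1.2 t + expR (- (mu a.1.1 * t)) *: (F a).1 t) (F a).2}.
  apply: (@choice _ _ (fun a b => expansion_stage Gm a.1.1 a.1.2 a.2 ->
    S_polynomial b.1 /\ expansion_stage Gm a.1.1.+1
      (fun t => a.1.2 t + expR (- (mu a.1.1 * t)) *: b.1 t) b.2)).
  move=> [[N P] L]; have [st|nst] := pselect (expansion_stage Gm N P L).
    have [q [L' qP]] := expansion_step GmH GmT ydecay st.
    by exists (q, L').
  by exists (fun=> 0, fun=> 0).
pose next N (PL : (R -> 'cV[R]_n) * (R -> 'cV[R]_n)) := F (N, PL.1, PL.2).
pose st := fix st N : (R -> 'cV[R]_n) * (R -> 'cV[R]_n) :=
  if N is N'.+1 then
    (fun t => (st N').1 t + expR (- (mu N' * t)) *: (next N' (st N')).1 t,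
     (next N' (st N')).2)
  else (fun=> 0, fun=> 0).
have stP N : expansion_stage Gm N (st N).1 (st N).2.
  elim: N => [|N ih]; last by have [] := FP (N, (st N).1, (st N).2) ih.
  apply: expansion_stage0; apply: ydecay; have := mu_pos 0; lra.
pose qh N := (next N (st N)).1.
have stE N t : (st N).1 t = \sum_(k < N) expR (- (mu k * t)) *: qh k t.
  by elim: N => [|N ih]; [rewrite big_ord0|rewrite big_ord_recr /= -ih].
exists qh; split=> [k|N].
  by have [] := FP (k, (st k).1, (st k).2) (stP k).
(* Stage [N.+1] is the one whose partial sum ends with index [N]. *)
have [_ _ _ [nu [munu _ dnu]]] := stP N.+1.
exists nu; split; first exact: munu.
apply: decay_bigO => i; apply: eventually_decay (dnu i) _; exists 0 => t _.
by rewrite -stE !mxE.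
Qed.

End AsymptoticExpansion.

Theorem theorem10p10 (R : realType) (n : nat) (hn : (0 < n)%N)
  (A : 'M[R]_n)
  (hA : forall z : R[i], complex_eigenvalue A z -> 0 < complex.Re z)
  (G : 'cV[R]_n -> 'cV[R]_n) (hG : assumption_G G)
  (f : R -> 'cV[R]_n)
  (hf : exists Tf : R, 0 <= Tf /\ {within `[Tf, +oo[, continuous f})
  (T0 : R) (hT0 : 0 <= T0)
  (y : R -> 'cV[R]_n) (hy : C1_after T0 y)
  (hode : forall t, T0 < t -> derive1 y t = - (A *m y t) + G (y t) + f t)
  (hy0 : y t @[t --> +oo] --> (0 : 'cV[R]_n))
  (mu : nat -> R)
  (hmu_pos : forall k, 0 < mu k)
  (hmu_incr : forall j k, (j < k)%N -> mu j < mu k)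
  (hmu_div : mu @ \oo --> +oo)
  (hmu_add : forall x x', range mu x -> range mu x' -> range mu (x + x'))
  (hmu_spec : [set complex.Re z | z in complex_eigenvalue A] `<=` range mu)
  (fh : nat -> R -> 'cV[R]_n) (hfh : expansion f fh mu) :
  exists qh : nat -> R -> 'cV[R]_n, expansion y qh mu.
Proof.
apply: (@solution_expansion R n A G f y T0 mu fh) => //; last first.
  by move=> x xA; apply: hmu_spec; exists x.
move=> i t T0t; have [dy _] := hy; have dyt := dy t T0t.
(* The vector equation is read coordinate by coordinate. *)
have dyi := (derivable_mxP y t 1).1 dyt i 0.
apply: is_derive_eq (derivableP dyi) _.
have -> : 'D_1 (fun s => y s i 0) t = derive1 y t i 0.
  by rewrite derive1E derive_mx// mxE.
by rewrite hode// !mxE; ring.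
Qed.
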